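(* Let $\mathcal G$ be a class of (finite, undirected) graphs. The following four statements are equivalent. (1) $\mathcal G$ has structurally bounded treedepth, i.e., there exist a graph class $\mathcal G'$ of bounded treedepth and a first-order transduction $\tau$ such that $\mathcal G \subseteq \tau(\mathcal G')$. (2) There exists a number $d$ such that every graph in $\mathcal G$ has a lacon-decomposition $(L,\pi)$ with $\mathrm{wcol}_\infty(L,\pi)\le d$. (3) There exist a number $d$ and a signature $S$ such that every graph in $\mathcal G$ has a shrub-decomposition $(F,S)$ with one color, diameter at most $d$, and such that $F$ has treedepth at most $d$. (4) There exist a number $d$ and a graph class $\mathcal G'$ of bounded treedepth such that every graph in $\mathcal G$ has a parity-decomposition $P\in\mathcal G'$ of target-degree at most $d$.
   Context: A linear order on the vertices of a graph is an injective map $\pi: V\to\mathbb N$. A vertex $u$ is weakly $r$-reachable from $v$ (w.r.t. $\pi$) if there is a path of length at most $r$ from $v$ to $u$ such that $\pi(u)\le\pi(w)$ for all vertices $w$ on the path; $\mathrm{wcol}_r(G,\pi)$ is the maximum over $v$ of the number of vertices weakly $r$-reachable from $v$, and $\mathrm{wcol}_\infty(G,\pi)$ is the same quantity with no bound on the path length. Lacon-decomposition: a pair $(L,\pi)$ where $L$ is a bipartite graph with sides $T$ (target vertices) and $H$ (hidden vertices), each hidden vertex is labeled ''0'' or ''1'', $\pi$ is a linear order on $V(L)$ with $\pi(h)<\pi(t)$ for all $h\in H,t\in T$, and for all $t,t'\in T$ we have $N(t)\cap N(t')\neq\emptyset$; the $\pi$-largest vertex of $N(t)\cap N(t')$ is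 the dominant vertex of $t,t'$. It is a lacon-decomposition of a graph $G$ if $V(G)=T$ and for all $t\ne t'\in T$, $tt'\in E(G)$ iff the dominant vertex of $t,t'$ is labeled ''1''. Shrub-decomposition of $m$ colors and diameter $d$ of a graph $G$: a pair $(F,S)$ with $F$ an undirected graph and $S\subseteq\{1,\dots,m\}^2\times\{1,\dots,d\}$ such that any two vertices of $F$ have distance at most $d$ in $F$, the set of degree-one vertices of $F$ is exactly $V(G)$, each degree-one vertex of $F$ is assigned a color in $\{1,\dots,m\}$, $(i,j,l)\in S$ iff $(j,i,l)\in S$, and for all $u,v\in V(G)$ with colors $i,j$ and $F$-distance $l$, $uv\in E(G)$ iff $(i,j,l)\in S$. Parity-decomposition of target-degree $d$ of a graph $G$: a bipartite graph $P$ with sides $T,H$ in which every vertex of $T$ has degree at most $d$, $T=V(G)$, and for all $t\ne t'\in T$, $tt'\in E(G)$ iff $|N(t)\cap N(t')|$ is odd. First-order transductions: a basic transduction is a triple $\tau_0=(\chi,\nu,\varphi)$ of first-order formulas with $0,1,2$ free variables; $\tau_0(G)$ is undefined if $G\not\models\chi$, otherwise it is the graph with vertex set $\{v: G\models\nu(v)\}$ and edges $uv$ ($u\neq v$) with $G\models\varphi(u,v)\lor\varphi(v,u)$. A $p$-parameter expansion maps $G$ to the set of all graphs obtained by adding $p$ unary predicates to $G$. An $m$-copy operation maps $G$ to the graph with vertex set $V(G)\times\{1,\dots,m\}$, edges $(v,i)(w,i)$ for $vw\in E(G)$, a binary relation $\sim$ with $(u,i)\sim(v,j)$ iff $u=v$,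 and unary predicates $Q_i=V(G)\times\{i\}$. A transduction is $\tau=\tau_0\circ\gamma\circ\varepsilon$ with $\varepsilon$ a parameter expansion, $\gamma$ a copy operation, $\tau_0$ a basic transduction; $\tau(\mathcal G')=\bigcup_{G\in\mathcal G'}\tau(G)$. *)

(* Defs.v *)
From mathcomp Require Import all_boot.
(* Only for deciding the existence of a path, to count end vertices. *)
From mathcomp Require Import boolp.

Set Implicit Arguments.
Unset Strict Implicit.
Unset Printing Implicit Defensive.

Record sgraph := SGraph {
  vertex :> finType;
  adj : rel vertex;
  adj_sym : symmetric adj;
  adj_irr : irreflexive adj }.

(* A class need not be closed under isomorphism. *)
Definition graph_class := sgraph -> Prop.

Definition isomorphic (G H : sgraph) : Prop :=
  exists2 f : G -> H, bijective f & forall x y, adj (f x) (f y) = adj x y.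

Definition nbr (G : sgraph) (x : G) : {set G} := [set y | adj x y].

(* [x :: p] is the vertex sequence of a path from [x] to [y]; its length
   (number of edges) is [size p]. *)
Definition is_path (G : sgraph) (x y : G) (p : seq G) : bool :=
  [&& path (@adj G) x p, last x p == y & uniq (x :: p)].

Definition is_dist (G : sgraph) (x y : G) (l : nat) : Prop :=
  (exists2 p, is_path x y p & size p = l) /\
  (forall p, is_path x y p -> l <= size p).

Section Bipartite.
Variables (T H : finType) (e : T -> H -> bool).

Definition bip_adj (x y : T + H) : bool :=
  match x, y with
  | inl t, inr h => e t h
  | inr h, inl t => e t h
  | _, _ => false
  end.

Fact bip_adj_sym : symmetric bip_adj.
Proof. by case=> [t|h] [t'|h']. Qed.

Fact bip_adj_irr : irreflexive bip_adj.
Proof. by case. Qed.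

Definition bip_graph : sgraph := SGraph bip_adj_sym bip_adj_irr.

End Bipartite.

Section Treedepth.
Variable G : sgraph.

(* A rooted forest on the vertices of [G] is given by its parent function,
   [None] marking the roots. Climbing [k] times from any vertex leaves the
   forest iff every root-to-leaf path has at most [k] vertices; in particular
   this rules out cycles of the parent function. *)
Definition forest_height_le (parent : {ffun G -> option G}) (k : nat) : bool :=
  [forall v, iter k (obind parent) (Some v) == None].

Definition ancestor (parent : {ffun G -> option G}) (u v : G) : bool :=
  connect (fun x y => parent x == Some y) v u.

Definition has_elimination_forest (k : nat) : bool :=
  [exists parent : {ffun G -> option G},
     forest_height_le parent k &&
     [forall u, forall v,
        adj u v ==> (ancestor parent u v || ancestor parent v u)]].

Fact has_elimination_forest_ex : exists k, has_elimination_forest k.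
Proof.
have [s us ms] : exists2 s : seq G, uniq s & forall x, x \in s.
  by exists (enum G) => [|x]; rewrite ?enum_uniq ?mem_enum.
pose f := [ffun x => onth s (index x s).+1].
have it k x : iter k (obind f) (Some x) = onth s (index x s + k).
  elim: k => [|k IHk] /=.
    by rewrite addn0 onthE (nth_map x) ?index_mem // nth_index.
  rewrite IHk addnS.
  have [lt|ge] := ltnP (index x s + k) (size s).
    by rewrite [onth s (_ + k)]onthE (nth_map x) //= ffunE index_uniq.
  by rewrite !onthE !nth_default ?size_map // leqW.
exists (size s); apply/existsP; exists f; apply/andP; split.
  by apply/forallP => x; rewrite it onthE nth_default // size_map leq_addl.
have up k x y : iter k (obind f) (Some x) = Some y -> ancestor f y x.
  elim: k y => [|k IHk] y /=; first by case=> ->; apply: connect0.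
  case E: (iter k _ _) => [z|] //= fz.
  by apply: connect_trans (IHk _ E) (connect1 _); rewrite fz.
have anc x y : index x s <= index y s -> ancestor f y x.
  move=> le; apply: (up (index y s - index x s)).
  by rewrite it subnKC // onthE (nth_map y) ?index_mem // nth_index.
apply/forallP => x; apply/forallP => y; apply/implyP => _.
by case: (leqP (index x s) (index y s)) => [/anc ->|/ltnW/anc ->]; rewrite ?orbT.
Qed.

Definition treedepth : nat := ex_minn has_elimination_forest_ex.

End Treedepth.

Definition bounded_treedepth (C : graph_class) : Prop :=
  exists k, forall G, C G -> treedepth G <= k.

Definition weakly_reachable (G : sgraph) (pi : G -> nat) (v u : G) : Prop :=
  exists2 p, is_path v u p & forall w, w \in v :: p -> pi u <= pi w.

Definition wcol_infty (G : sgraph) (pi : G -> nat) : nat :=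
  \max_(v : G) #|[set u : G | `[< weakly_reachable pi v u >]]|.

Definition dominant (L : sgraph) (pi : L -> nat) (t t' h : L) : Prop :=
  h \in nbr t :&: nbr t' /\
  forall h', h' \in nbr t :&: nbr t' -> pi h' <= pi h.

(* The target side is the vertex set of [G], the hidden side is [H]; the
   label of a hidden vertex is "1" iff [label] is true. *)
Definition lacon_decomposition (G : sgraph) (H : finType) (e : G -> H -> bool)
    (label : H -> bool) (pi : bip_graph e -> nat) : Prop :=
  [/\ injective pi,
      forall (h : H) (t : G), pi (inr h) < pi (inl t),
      forall t t' : G,
        nbr (inl t : bip_graph e) :&: nbr (inl t' : bip_graph e) != set0 &
      forall t t' : G, t != t' ->
        forall h : H, dominant pi (inl t) (inl t') (inr h) ->
          adj t t' = label h].

Record signature (m d : nat) := Signature {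
  sig_rel :> 'I_m -> 'I_m -> nat -> bool;
  sig_bound : forall i j l, sig_rel i j l -> 1 <= l <= d;
  sig_sym : forall i j l, sig_rel i j l = sig_rel j i l }.

(* [iota] identifies the vertices of [G] with the degree-one vertices of [F]. *)
Definition shrub_decomposition (m d : nat) (G F : sgraph) (iota : G -> F)
    (color : G -> 'I_m) (S : signature m d) : Prop :=
  [/\ forall x y : F, exists2 l, l <= d & is_dist x y l,
      injective iota,
      forall x : F, #|nbr x| = 1 <-> exists u, iota u = x &
      forall (u v : G) (l : nat), is_dist (iota u) (iota v) l ->
        adj u v = S (color u) (color v) l].

Definition parity_decomposition (d : nat) (G : sgraph) (H : finType)
    (e : G -> H -> bool) : Prop :=
  (forall t : G, #|nbr (inl t : bip_graph e)| <= d) /\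
  (forall t t' : G, t != t' ->
     adj t t' =
     odd #|nbr (inl t : bip_graph e) :&: nbr (inl t' : bip_graph e)|).

Section FirstOrder.
Variables p m : nat.

(* Formulas over the vocabulary made of equality, the edge relation, the
   binary relation ~, the [p] parameters and the [m] copy predicates.
   [formula n] has its free variables among [n]; under [FEx] the variable
   [ord0] is the bound one and the free variable [i] becomes [lift ord0 i]. *)
Inductive formula : nat -> Type :=
  | FFalse n : formula n
  | FEq n : 'I_n -> 'I_n -> formula n
  | FAdj n : 'I_n -> 'I_n -> formula n
  | FSim n : 'I_n -> 'I_n -> formula n
  | FParam n : 'I_p -> 'I_n -> formula n
  | FCopy n : 'I_m -> 'I_n -> formula n
  | FNot n : formula n -> formula n
  | FAnd n : formula n -> formula n -> formula n
  | FEx n : formula n.+1 -> formula n.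

Record fo_structure := FOStructure {
  fo_sort :> finType;
  fo_adj : rel fo_sort;
  fo_sim : rel fo_sort;
  fo_param : 'I_p -> pred fo_sort;
  fo_copy : 'I_m -> pred fo_sort }.

Definition env_cons (U : Type) (n : nat) (x : U) (s : 'I_n -> U) :
    'I_n.+1 -> U :=
  fun i => if unlift ord0 i is Some j then s j else x.

Definition env_nil (U : Type) : 'I_0 -> U :=
  fun i => False_rect U (notF (ltn_ord i)).

Fixpoint sat (U : fo_structure) (n : nat) (f : formula n) :
    ('I_n -> U) -> bool :=
  match f with
  | FFalse _ => fun _ => false
  | FEq _ i j => fun s => s i == s j
  | FAdj _ i j => fun s => fo_adj (s i) (s j)
  | FSim _ i j => fun s => fo_sim (s i) (s j)
  | FParam _ k i => fun s => fo_param k (s i)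
  | FCopy _ k i => fun s => fo_copy k (s i)
  | FNot _ g => fun s => ~~ sat g s
  | FAnd _ g h => fun s => sat g s && sat h s
  | FEx _ g => fun s => [exists x, sat g (env_cons x s)]
  end.

Definition sat0 (U : fo_structure) (f : formula 0) : bool :=
  sat f (@env_nil U).
Definition sat1 (U : fo_structure) (f : formula 1) (x : U) : bool :=
  sat f (env_cons x (@env_nil U)).
Definition sat2 (U : fo_structure) (f : formula 2) (x y : U) : bool :=
  sat f (env_cons x (env_cons y (@env_nil U))).

(* The [m]-copy of the expansion of [G] by the parameters [P]; a copy of a
   vertex satisfies the same parameters as the vertex itself. *)
Definition copy_structure (G : sgraph) (P : 'I_p -> pred G) : fo_structure :=
  @FOStructure (G * 'I_m)%type
    (fun x y => adj x.1 y.1 && (x.2 == y.2))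
    (fun x y => x.1 == y.1)
    (fun k x => P k x.1)
    (fun i x => x.2 == i).

Section Interpretation.
Variables (U : fo_structure) (nu : formula 1) (phi : formula 2).

Definition interp_adj (x y : {x : U | sat1 nu x}) : bool :=
  (x != y) && (sat2 phi (val x) (val y) || sat2 phi (val y) (val x)).

Fact interp_adj_sym : symmetric interp_adj.
Proof. by move=> x y; rewrite /interp_adj eq_sym orbC. Qed.

Fact interp_adj_irr : irreflexive interp_adj.
Proof. by move=> x; rewrite /interp_adj eqxx. Qed.

Definition interp_graph : sgraph := SGraph interp_adj_sym interp_adj_irr.

End Interpretation.

End FirstOrder.

Record transduction := Transduction {
  tr_params : nat;
  tr_copies : nat;
  tr_chi : formula tr_params tr_copies 0;
  tr_nu : formula tr_params tr_copies 1;
  tr_phi : formula tr_params tr_copies 2 }.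

(* The class of all graphs produced from members of [C], up to isomorphism. *)
Definition transduce (tau : transduction) (C : graph_class) : graph_class :=
  fun K => exists G : sgraph, C G /\
    exists P : 'I_(tr_params tau) -> pred G,
      let U := copy_structure (tr_copies tau) P in
      sat0 U (tr_chi tau) /\
      isomorphic K (interp_graph U (tr_nu tau) (tr_phi tau)).

Definition structurally_bounded_treedepth (C : graph_class) : Prop :=
  exists (C' : graph_class) (tau : transduction),
    bounded_treedepth C' /\ forall G, C G -> transduce tau C' G.

Definition bounded_lacon_decompositions (C : graph_class) : Prop :=
  exists d : nat, forall G, C G ->
    exists (H : finType) (e : G -> H -> bool) (label : H -> bool)
           (pi : bip_graph e -> nat),
      lacon_decomposition label pi /\ wcol_infty pi <= d.

Definition bounded_shrub_decompositions (C : graph_class) : Prop :=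
  exists (d : nat) (S : signature 1 d), forall G, C G ->
    exists (F : sgraph) (iota : G -> F) (color : G -> 'I_1),
      shrub_decomposition iota color S /\ treedepth F <= d.

Definition bounded_parity_decompositions (C : graph_class) : Prop :=
  exists (d : nat) (C' : graph_class),
    bounded_treedepth C' /\
    forall G, C G ->
      exists (H : finType) (e : G -> H -> bool),
        C' (bip_graph e) /\ parity_decomposition d e.

(* Main.v *)
Require Import Defs.
From mathcomp Require Import all_boot.
From mathcomp Require Import boolp.
From mathcomp Require Import zify.

Set Implicit Arguments.
Unset Strict Implicit.
Unset Printing Implicit Defensive.

(** All four properties are equivalent to the existence, for every graph of the
    class, of a tree model: an ultrametric [D] on the vertices with values
    bounded by a constant and a colouring with boundedly many colours such that
    the adjacency of [x] and [y] is a function of [D x y] and of the two colours.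

    (1) gives tree models: the depth at which two vertices separate in an
    elimination forest is an ultrametric that, together with a colouring,
    determines the atomic formulas, and this is preserved by quantification: the
    colour of a point only has to record also, for every ball around it, how many
    child balls contain each colour, up to a threshold.

    From a tree model, let every pair of a ball and a set of colours be a hidden
    vertex, adjacent to the points of the ball whose colour is in the set. The
    common neighbours of [x] and [y] are the pairs with a ball of radius at least
    [D x y] and a set containing both colours; the smallest such ball with the
    smallest such set determines adjacency, so it can be made dominant (2), and
    Moebius inversion over GF(2) selects hidden vertices for which the parity of
    the number of common neighbours is adjacency (4). For (3), take the tree of
    balls and hang [x] below its point by a path whose length encodes the colour
    by a power of two, so that a distance [2 D x y + tau (c x) + tau (c y)]
    determines [D x y] and the pair of colours.

    Conversely, (2), (3) and (4) lead back to (1) by explicit formulas, as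
    treedepth is at most [wcol_infty]. *)

(** * Treedepth and weak reachability *)

Lemma has_elimination_forestW (G : sgraph) k l :
  k <= l -> has_elimination_forest G k -> has_elimination_forest G l.
Proof.
move=> kl /existsP[f /andP[/forallP ht anc]]; apply/existsP; exists f.
rewrite anc andbT; apply/forallP => v; rewrite -(subnK kl) iterD (eqP (ht v)).
by elim: (l - k) => //= n /eqP ->.
Qed.

Lemma treedepth_leP (G : sgraph) k :
  reflect (has_elimination_forest G k) (treedepth G <= k).
Proof.
rewrite /treedepth; case: ex_minnP => n hn minn.
by apply: (iffP idP) => [nk|/minn//]; apply: has_elimination_forestW hn.
Qed.

Section ForestOrder.
Variables (G : sgraph) (le : rel G).
Hypotheses (le_refl : reflexive le) (le_anti : antisymmetric le)
  (le_trans : transitive le)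
  (le_chain : forall u v w, le u w -> le v w -> le u v || le v u).

Let down v := [set u | le u v].

Let max_below (v u : G) :=
  [&& u != v, le u v & [forall w, (w != v) && le w v ==> le w u]].

Let parent := [ffun v => [pick u | max_below v u]].

Let card_down_lt u v : u != v -> le u v -> #|down u| < #|down v|.
Proof.
move=> uv luv; apply: proper_card; apply/properP; split.
  by apply/subsetP => w; rewrite !inE => /le_trans; apply.
exists v; rewrite !inE ?le_refl //; apply: contra uv => lvu.
by apply/eqP/le_anti; rewrite luv.
Qed.

Let parentP u v : u != v -> le u v ->
  exists2 w, parent v = Some w & max_below v w.
Proof.
move=> uv luv; rewrite ffunE; case: pickP => [w mw|no]; first by exists w.
pose P w := (w != v) && le w v.
have Pu : P u by rewrite /P uv.
(* The elements strictly below [v] form a chain, so the one with the largest down-set is the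
   greatest. *)
case: (arg_maxnP (fun w => #|down w|) Pu) => w /andP[wv lwv] wmax.
suff : max_below v w by rewrite no.
rewrite /max_below wv lwv; apply/forallP => z; apply/implyP => Pz.
have /andP[zv lzv] := Pz.
have [->//|wz] := eqVneq z w.
have /orP[//|lwz] := le_chain lzv lwv.
have := card_down_lt (_ : w != z) lwz; rewrite eq_sym => /(_ wz).
by rewrite ltnNge [_ <= _](wmax z Pz).
Qed.

(** The parent of [v] is the greatest element strictly below it. Each climb shrinks the down-set, so
    [n] climbs leave the forest, and climbing from [v] meets everything below [v]. *)
Lemma forest_order_treedepth n :
  (forall v, #|[set u | le u v]| <= n) ->
  (forall u v, adj u v -> le u v || le v u) -> treedepth G <= n.
Proof.
move=> card_le comp; apply/treedepth_leP/existsP; exists parent.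
apply/andP; split.
  apply/forallP => v; move: (card_le v).
  elim: n v {card_le} => [v|n IHn v]; rewrite -/(down v) => cv.
    by move: cv; rewrite leqn0 cards_eq0 => /eqP/setP/(_ v); rewrite !inE le_refl.
  rewrite iterSr /=; case E: (parent v) => [u|] /=; last first.
    by elim: (n) => //= k /eqP ->.
  apply: IHn; rewrite -ltnS; apply: leq_trans cv; move: E; rewrite ffunE.
  by case: pickP => // w /and3P[wv lwv _] [<-]; apply: card_down_lt.
have anc u v : le u v -> ancestor parent u v.
  elim: {v}_.+1 {-2}v (ltnSn #|down v|) => // k IHk v cv luv.
  have [->|uv] := eqVneq u v; first exact: connect0.
  have [w pw /and3P[wv lwv /forallP /(_ u)]] := parentP uv luv.
  rewrite uv luv => luw; apply: connect_trans (connect1 _) (IHk w _ luw).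
    by rewrite /= pw.
  by rewrite ltnS in cv; apply: leq_trans cv; apply: card_down_lt.
apply/forallP => u; apply/forallP => v; apply/implyP => /comp.
by case/orP=> /anc ->; rewrite ?orbT.
Qed.

End ForestOrder.

Section WeakReachability.
Variables (G : sgraph) (pi : G -> nat).

(** Weak reachability of [u] is connectedness in the subgraph induced by the vertices of order at
    least [pi u]; this form composes without simple paths. *)
Let above u : rel G := [rel x y | [&& adj x y, pi u <= pi x & pi u <= pi y]].

Let above_sym u : connect_sym (above u).
Proof.
by apply: sym_connect_sym => x y; rewrite /above /= adj_sym [(pi u <= pi x) && _]andbC.
Qed.

Let weakly_reachable_connect v u :
  weakly_reachable pi v u <-> connect (above u) v u.
Proof.
split=> [[p /and3P[pp /eqP <- _] lep]|/connectP[p]].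
  apply/connectP; exists p => //.
  elim: p v pp lep => //= w p IHp v /andP[vw pp] lep.
  rewrite {1}/above /= vw !lep ?inE ?eqxx ?orbT //=.
  by apply: IHp => // z zp; rewrite lep // inE zp orbT.
case/shortenP=> q pq uq _ Eu; exists q.
  rewrite /is_path uq -Eu eqxx !andbT.
  by apply: sub_path pq => x y /andP[].
move=> w; rewrite inE; have [->{w} _|wv /=] := eqVneq w v.
  by case: q pq Eu {uq} => [_ ->//|x q /= /andP[/and3P[]]].
elim: q v pq wv {uq Eu} => //= x q IHq v /andP[/and3P[_ _ ux] pq] _.
rewrite inE; have [->//|wx /=] := eqVneq w x; exact: (IHq x).
Qed.

Lemma weakly_reachable_refl v : weakly_reachable pi v v.
Proof. exact/weakly_reachable_connect/connect0. Qed.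

Lemma weakly_reachable_le v u : weakly_reachable pi v u -> pi u <= pi v.
Proof. by case=> p _; apply; rewrite mem_head. Qed.

Let above_mono u w : pi u <= pi w -> subrel (connect (above w)) (connect (above u)).
Proof.
move=> uw; apply: connect_sub => x y /and3P[xy wx wy]; apply: connect1.
by rewrite /above /= xy !(leq_trans uw).
Qed.

Lemma weakly_reachable_trans w v u :
  weakly_reachable pi v w -> weakly_reachable pi w u -> weakly_reachable pi v u.
Proof.
move=> vw wu; have uw := weakly_reachable_le wu.
apply/weakly_reachable_connect; move/weakly_reachable_connect: wu.
by apply: connect_trans; apply/(above_mono uw)/weakly_reachable_connect.
Qed.

Lemma weakly_reachable_chain v u w :
  weakly_reachable pi v u -> weakly_reachable pi v w -> pi u <= pi w ->
  weakly_reachable pi w u.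
Proof.
move=> /weakly_reachable_connect vu /weakly_reachable_connect vw uw.
apply/weakly_reachable_connect; apply: connect_trans vu; rewrite above_sym.
exact: above_mono vw.
Qed.

Lemma weakly_reachable_adj v u :
  adj v u -> pi u <= pi v -> weakly_reachable pi v u.
Proof.
by move=> vu le; apply/weakly_reachable_connect/connect1; rewrite /above /= vu le leqnn.
Qed.

(** Weak reachability is a forest order whose down-sets are the sets counted by [wcol_infty]; of two
    adjacent vertices, the smaller is weakly reachable from the larger. *)
Lemma treedepth_le_wcol : injective pi -> treedepth G <= wcol_infty pi.
Proof.
move=> pi_inj.
apply: (@forest_order_treedepth _ (fun u v => `[< weakly_reachable pi v u >])).
- by move=> v; apply/asboolP/weakly_reachable_refl.
- move=> u v /andP[/asboolP/weakly_reachable_le uv /asboolP/weakly_reachable_le vu].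
  by apply: pi_inj; apply/eqP; rewrite eqn_leq uv.
- move=> w u v /asboolP uw /asboolP wv; apply/asboolP.
  exact: weakly_reachable_trans wv uw.
- move=> u v w /asboolP uw /asboolP vw; apply/orP.
  have [uv|/ltnW vu] := leqP (pi u) (pi v); [left|right]; apply/asboolP.
    exact: weakly_reachable_chain uw vw uv.
  exact: weakly_reachable_chain vw uw vu.
- by move=> v; rewrite /wcol_infty (bigD1 v) //= leq_maxl.
- move=> u v uv; apply/orP.
  have [le|/ltnW le] := leqP (pi u) (pi v); [left|right];
    by apply/asboolP/weakly_reachable_adj; rewrite // adj_sym.
Qed.

End WeakReachability.

(** * Preorders of balls in an ultrametric space *)

(** Ties are broken by appending [enum_rank x] to [key x] as a last digit in base [#|T|]. *)
Lemma injective_refinement (T : finType) (key : T -> nat) :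
  exists2 pi : T -> nat, injective pi & forall x y, key x < key y -> pi x < pi y.
Proof.
exists (fun x => key x * #|T| + enum_rank x) => [x y /eqP|x y xy].
  have := ltn_ord (enum_rank x); have := ltn_ord (enum_rank y).
  move=> ly lx exy; apply/enum_rank_inj/val_inj => /=.
  by have /eqP := congr1 (modn^~ #|T|) (eqP exy); rewrite !modnMDl !modn_small // => /eqP.
apply: leq_trans (leq_addr _ _); apply: leq_trans (_ : (key x).+1 * #|T| <= _).
  by rewrite mulSnr -addnS leq_add2l ltn_ord.
by rewrite leq_mul2r xy orbT.
Qed.

Section TreePreorder.
Variables (G : sgraph) (le : rel G) (n : nat).
Hypotheses (le_refl : reflexive le) (le_trans : transitive le)
  (le_chain : forall u v w, le u w -> le v w -> le u v || le v u)
  (le_adj : forall u v, adj u v -> le u v || le v u)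
  (le_card : forall v, #|[set u | le u v]| <= n).

(** Everything weakly reachable from [v] is below [v], by induction along the path: if its first
    step goes up to [w], then [v] and the end [u] are both below [w], and [v] strictly below [u]
    would give [pi v < pi u]. *)
Lemma tree_preorder_wcol (pi : G -> nat) :
  (forall u v, le u v -> ~~ le v u -> pi u < pi v) -> wcol_infty pi <= n.
Proof.
move=> mono; apply/bigmax_leqP => v _; apply: leq_trans (le_card v).
apply/subset_leq_card/subsetP => u; rewrite !inE => /asboolP[p /and3P[pp /eqP pu _]].
elim: p v pp pu => [v _ <-//|w p IHp v /= /andP[vw pp] pu lep].
have luw : le u w by apply: IHp => // z zp; rewrite lep // inE zp orbT.
have /orP[lvw|/(le_trans luw)//] := le_adj vw.
have /orP[//|lvu] := le_chain luw lvw; apply: contraT => nluv.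
by have := mono _ _ lvu nluv; rewrite ltnNge lep // mem_head.
Qed.

Lemma tree_preorder_treedepth : treedepth G <= n.
Proof.
have [pi pi_inj pi_mono] := injective_refinement (fun v => #|[set u | le u v]|).
apply: leq_trans (treedepth_le_wcol pi_inj) (tree_preorder_wcol _) => u v uv nvu.
apply/pi_mono/proper_card/properP; split.
  by apply/subsetP => w; rewrite !inE => /le_trans; apply.
by exists v; rewrite !inE ?le_refl.
Qed.

End TreePreorder.

Definition ultrametric (T : finType) (k : nat) (D : T -> T -> nat) : Prop :=
  [/\ forall x y, (D x y == 0) = (x == y),
      forall x y, D x y = D y x,
      forall x y z, D x z <= maxn (D x y) (D y z) &
      forall x y, D x y <= k].

(* Depends only on the ball of radius [l] around [x] when [D] is an ultrametric. *)
Definition ball_rep (T : finType) (D : T -> T -> nat) (x : T) (l : nat) : T :=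
  odflt x [pick y | D x y <= l].

Section Ultrametric.
Variables (T : finType) (k : nat) (D : T -> T -> nat).
Hypothesis D_um : ultrametric k D.

Lemma um_eq0 x y : (D x y == 0) = (x == y). Proof. by case: D_um. Qed.

Lemma um_refl x : D x x = 0. Proof. by apply/eqP; rewrite um_eq0. Qed.

Lemma um_sym x y : D x y = D y x. Proof. by case: D_um. Qed.

Lemma um_tri y x z l : D x y <= l -> D y z <= l -> D x z <= l.
Proof.
by move=> xy yz; case: D_um => _ _ tri _; apply: leq_trans (tri x y z) _; rewrite geq_max xy.
Qed.

Lemma um_bound x y : D x y <= k. Proof. by case: D_um. Qed.

(** The two longest sides of an ultrametric triangle are equal. *)
Lemma um_isosceles x y z : D x y <= D x z -> D x z = maxn (D x y) (D y z).
Proof.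
case: D_um => _ _ tri _ le; apply/eqP; rewrite eqn_leq tri geq_max le.
by have := tri y x z; rewrite (um_sym y x) (maxn_idPr le).
Qed.

Lemma ball_repP x l : D x (ball_rep D x l) <= l.
Proof. by rewrite /ball_rep; case: pickP => //= _; rewrite um_refl. Qed.

Lemma ball_rep_eq x y l : (ball_rep D x l == ball_rep D y l) = (D x y <= l).
Proof.
apply/eqP/idP => [E|xy].
  apply: (um_tri (ball_repP x l)); rewrite um_sym E; exact: ball_repP.
rewrite /ball_rep (@eq_pick _ _ (fun z => D y z <= l)).
  by case: pickP => // /(_ y); rewrite um_refl.
by move=> z; apply/idP/idP; apply: um_tri; rewrite // um_sym.
Qed.

Lemma ball_rep_id x l : ball_rep D (ball_rep D x l) l = ball_rep D x l.
Proof. by apply/eqP; rewrite ball_rep_eq um_sym ball_repP. Qed.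

Lemma ball_rep_nest x l l' : l <= l' -> ball_rep D (ball_rep D x l) l' = ball_rep D x l'.
Proof.
by move=> ll'; apply/eqP; rewrite ball_rep_eq um_sym (leq_trans (ball_repP _ _)).
Qed.

Lemma ball_rep0 x : ball_rep D x 0 = x.
Proof. by apply/eqP; rewrite eq_sym -um_eq0 -leqn0 ball_repP. Qed.

Section BallOrder.
Variables (G : sgraph) (pt : G -> T) (lv : G -> nat) (n N : nat).

(** A vertex [v] stands for the ball of radius [lv v] around [pt v]; larger balls come first, as
    ancestors of the balls they contain. Distinct vertices may share a ball, so this is only a
    preorder. *)
Definition ball_le (u v : G) := (lv v <= lv u) && (pt u == ball_rep D (pt v) (lv u)).

Hypotheses (canonical : forall v, pt v = ball_rep D (pt v) (lv v))
  (lv_bound : forall v, lv v <= n)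
  (fiber_bound : forall x l, #|[set v | (pt v == x) && (lv v == l)]| <= N)
  (ball_adj : forall u v, adj u v -> ball_le u v || ball_le v u).

Let ball_le_refl : reflexive ball_le.
Proof. by move=> v; rewrite /ball_le leqnn -canonical eqxx. Qed.

Let ball_le_trans : transitive ball_le.
Proof.
move=> v u w /andP[vu /eqP Eu] /andP[wv /eqP Ev].
by rewrite /ball_le (leq_trans wv) // Eu Ev ball_rep_nest ?eqxx.
Qed.

Let ball_le_chain u v w : ball_le u w -> ball_le v w -> ball_le u v || ball_le v u.
Proof.
wlog vu : u v / lv v <= lv u => [W|/andP[wu /eqP Eu] /andP[wv /eqP Ev]].
  by case/orP: (leq_total (lv v) (lv u)) => le uw vw; [|rewrite orbC]; apply: W.
by rewrite /ball_le vu Ev ball_rep_nest // -Eu eqxx.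
Qed.

Let ball_le_card v : #|[set u | ball_le u v]| <= n.+1 * N.
Proof.
pose B (l : 'I_n.+1) := [set u | (pt u == ball_rep D (pt v) l) && (lv u == l)].
apply: (@leq_trans #|\bigcup_l B l|).
  apply/subset_leq_card/subsetP => u; rewrite inE => /andP[_ pu].
  by apply/bigcupP; exists (inord (lv u)); rewrite // inE inordK ?pu //= ltnS.
apply: (@leq_trans (\sum_(l < n.+1) N)); last by rewrite sum_nat_const card_ord.
elim/big_ind2: _ => [|A a B' b Aa Bb|l _]; rewrite ?cards0 ?fiber_bound //.
by rewrite cardsU; lia.
Qed.

Lemma ball_order_treedepth : treedepth G <= n.+1 * N.
Proof. by apply: tree_preorder_treedepth ball_le_card. Qed.

Lemma ball_order_wcol (pi : G -> nat) :
  (forall u v, lv v < lv u -> pi u < pi v) -> wcol_infty pi <= n.+1 * N.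
Proof.
move=> mono; apply: (@tree_preorder_wcol _ ball_le) => // u v /andP[vu /eqP Eu] nvu.
apply: mono; rewrite ltn_neqAle vu andbT; apply: contraNneq nvu => E.
by rewrite /ball_le E leqnn Eu -E -canonical -canonical eqxx.
Qed.

End BallOrder.
End Ultrametric.

(** The balls of [D] form a tree of height at most [k] with the vertices as leaves, and [D x y] is
    the level of a lowest common ancestor: these are the tree models known from shrub-depth. *)
Definition has_tree_models (C : graph_class) : Prop :=
  exists (k : nat) (K : finType) (R : nat -> K -> K -> bool),
  forall G, C G -> exists (D : G -> G -> nat) (c : G -> K),
    ultrametric k D /\ forall x y : G, x != y -> adj x y = R (D x y) (c x) (c y).

(** * Parity- and lacon-decompositions from tree models *)

(** The parity at [x] involves [g x] and values of [g] at elements of smaller [m], so recursion on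
    [m] can choose [g x] to correct it. *)
Lemma odd_moebius (X : finType) (le : rel X) (m : X -> nat) (lab : pred X) :
  reflexive le -> (forall x y, le x y -> y != x -> m y < m x) ->
  exists g : pred X, forall x, odd #|[set y | le x y & g y]| = lab x.
Proof.
move=> le_refl lt_m.
suff [g gP] : exists g : pred X,
    forall x, m x < (\max_x m x).+1 -> odd #|[set y | le x y & g y]| = lab x.
  by exists g; move=> x; apply: gP; rewrite ltnS; apply: leq_bigmax.
elim: _.+1 => [|n [g gP]]; first by exists xpredT.
pose g' y := if m y < n then g y
             else lab y (+) odd #|[set z | [&& le y z, z != y & g z]]|.
exists g' => x; rewrite ltnS => le_x.
have sub y : m y <= n -> [set z | le y z & g' z] :\ y = [set z | [&& le y z, z != y & g z]].
  move=> ly; apply/setP => z; rewrite !inE; case: eqVneq => [_|zy]; rewrite ?andbF //=.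
  have [yz|//] := boolP (le y z); rewrite /= /g' ifT //.
  exact: leq_trans (lt_m _ _ yz zy) ly.
have [lt|ge] := ltnP (m x) n.
  rewrite -(gP x lt); congr (odd #|pred_of_set _|); apply/setP => z; rewrite !inE.
  have [xz|//] := boolP (le x z); rewrite /g'; have [->|zx] := eqVneq z x; first by rewrite lt.
  by rewrite (ltn_trans (lt_m _ _ xz zx) lt).
rewrite (cardsD1 x) sub // oddD !inE le_refl /= /g' ltnNge ge /=.
by rewrite oddb addbK.
Qed.

Section TreeModel.
Variables (G : sgraph) (k : nat) (K : finType) (R : nat -> K -> K -> bool).
Variables (D : G -> G -> nat) (c : G -> K).
Hypothesis D_um : ultrametric k D.
Hypothesis adjR : forall x y : G, x != y -> adj x y = R (D x y) (c x) (c y).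

Let gadget : finType := ('I_k.+1 * {set K})%type.

(** The label is read off any pair realising the gadget; by [adj_colors] all such pairs agree. *)
Let adj_label (a : gadget) : bool :=
  [exists x : G, exists y : G,
    [&& x != y, D x y == a.1, [set c x; c y] == a.2 & adj x y]].

Let gadget_of (x y : G) : gadget := (inord (D x y), [set c x; c y]).

Let val_gadget_of x y : (gadget_of x y).1 = D x y :> nat.
Proof. by rewrite /= inordK // ltnS (um_bound D_um). Qed.

(** The colours match in order or crosswise; in the second case the symmetry of [adj] and [D]
    exchanges the points. *)
Lemma adj_colors x y x' y' : x != y -> x' != y' ->
  D x y = D x' y' -> [set c x; c y] = [set c x'; c y'] -> adj x y = adj x' y'.
Proof.
move=> xy xy' ED Ec; have yx' : y' != x' by rewrite eq_sym.
have [[Ex Ey]|[Ex Ey]] : (c x = c x' /\ c y = c y') \/ (c x = c y' /\ c y = c x').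
  move/setP: Ec => S; move: (S (c x)) (S (c y)) (S (c x')) (S (c y')).
  rewrite !inE !eqxx !orbT /= => /esym/orP[]/eqP E1 /esym/orP[]/eqP E2;
    rewrite ?E1 ?E2 ?orbb => E3 E4; [|by left|by right|].
  - by left; split=> //; apply/esym/eqP.
  - by right; split=> //; apply/esym/eqP.
by rewrite !adjR // ED Ex Ey.
by rewrite (adj_sym x') !adjR // ED Ex Ey (um_sym D_um).
Qed.

Let adj_label_gadget x y : x != y -> adj_label (gadget_of x y) = adj x y.
Proof.
move=> xy; apply/existsP/idP => [[x' /existsP[y' /and4P[xy' /eqP ED /eqP Ec]]]|axy].
  by rewrite -(adj_colors xy xy') // ED val_gadget_of.
by exists x; apply/existsP; exists y; rewrite xy axy val_gadget_of !eqxx.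
Qed.

Let ball : finType := {b : G * 'I_k.+1 | b.1 == ball_rep D b.1 b.2}.

Let ball_of (x : G) (l : 'I_k.+1) : ball :=
  Sub (ball_rep D x l, l) (introT eqP (esym (ball_rep_id D_um x l))).

Let hidden : finType := (ball * {set K})%type.

Let gadget_in (h : hidden) : gadget := ((val h.1).2, h.2).

Let hidden_of (x : G) (a : gadget) : hidden := (ball_of x a.1, a.2).

Section Selected.
Variable sel : pred gadget.

(** The first conjunct says that [x] lies in the ball of [h]. Hidden vertices outside [sel] stay in
    the graph as isolated vertices. *)
Definition tree_inc (x : G) (h : hidden) : bool :=
  [&& h == hidden_of x (gadget_in h), c x \in h.2 & sel (gadget_in h)].

Let pt (v : bip_graph tree_inc) : G :=
  match v with inl x => x | inr h => (val h.1).1 end.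
Let lv (v : bip_graph tree_inc) : nat :=
  match v with inl x => 0 | inr h => (val h.1).2 end.

Let pt_canonical v : pt v = ball_rep D (pt v) (lv v).
Proof.
case: v => [x|h] /=; first by rewrite (ball_rep0 D_um).
exact/eqP/(valP h.1).
Qed.

Let lv_bound v : lv v <= k.
Proof. by case: v => [x|h] //=; rewrite -ltnS. Qed.

Let fiber_bound x l : #|[set v | (pt v == x) && (lv v == l)]| <= #|{set K}|.+1.
Proof.
(* [None] stands for a target vertex, [Some s] for the hidden vertex with colour set [s]. *)
pose f (o : option {set K}) : bip_graph tree_inc :=
  if o is Some s then inr (ball_of x (inord l), s) else inl x.
rewrite -card_option -[leqRHS]cardsT; apply: leq_trans (leq_imset_card f _).
apply/subset_leq_card/subsetP => v; rewrite inE => /andP[/eqP Ex /eqP El].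
case: v Ex El => [z|[b s]] /= Ex El; apply/imsetP; first by exists None; rewrite //= Ex.
exists (Some s) => //=; congr (inr (_, _)); apply/val_inj => /=.
by rewrite -Ex -El inord_val -(eqP (valP b)) [LHS]surjective_pairing.
Qed.

Let inc_le x h : tree_inc x h -> ball_le D pt lv (inr h) (inl x).
Proof. by case/and3P=> /eqP -> _ _; rewrite /ball_le /=. Qed.

Let inc_adj (u v : bip_graph tree_inc) :
  adj u v -> ball_le D pt lv u v || ball_le D pt lv v u.
Proof. by case: u v => [x|h] [y|h'] //= /inc_le ->; rewrite ?orbT. Qed.

Lemma tree_inc_treedepth : treedepth (bip_graph tree_inc) <= k.+1 * #|{set K}|.+1.
Proof.
exact: (ball_order_treedepth D_um pt_canonical lv_bound fiber_bound inc_adj).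
Qed.

Lemma tree_inc_wcol (pi : bip_graph tree_inc -> nat) :
  (forall x h, pi (inr h) < pi (inl x)) ->
  (forall h h' : hidden, (gadget_in h').1 < (gadget_in h).1 -> pi (inr h) < pi (inr h')) ->
  wcol_infty pi <= k.+1 * #|{set K}|.+1.
Proof.
move=> pi1 pi2.
apply: (ball_order_wcol D_um pt_canonical lv_bound fiber_bound inc_adj).
by case=> [x|h] [y|h'] //=; apply: pi2.
Qed.

(** Common neighbours thus correspond to the selected gadgets above [gadget_of x y] in radius and
    colour set: each such [a] gives the single hidden vertex [hidden_of x a]. *)
Lemma tree_inc_common x y h : tree_inc x h && tree_inc y h =
  [&& h == hidden_of x (gadget_in h), D x y <= (gadget_in h).1,
      [set c x; c y] \subset h.2 & sel (gadget_in h)].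
Proof.
rewrite /tree_inc subUset !sub1set; have [Eh|] := eqVneq h; last by [].
have -> : (h == hidden_of y (gadget_in h)) = (D x y <= (gadget_in h).1).
  rewrite {1}Eh -(ball_rep_eq D_um); apply/eqP/eqP => [[]//|E].
  by congr (_, _); apply/val_inj; rewrite /= E.
by case: (sel _); rewrite ?andbT ?andbF //=; case: (_ \in _); rewrite //= andbC.
Qed.

End Selected.

Lemma tree_model_parity : exists sel : pred gadget,
  parity_decomposition (k.+1 * #|{set K}|) (tree_inc sel).
Proof.
pose le (a b : gadget) := (a.1 <= b.1) && (a.2 \subset b.2).
pose m (a : gadget) := (k - a.1) + (#|K| - #|a.2|).
have [|a b ab nab|sel selP] := @odd_moebius _ le m adj_label.
- by move=> a; rewrite /le leqnn subxx.
- case: a b ab nab => [i s] [j t] /andP[/= ij st] nst; rewrite /m /=.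
  have [Est|nst2] := eqVneq s t; last first.
    have lt : #|s| < #|t| by rewrite proper_card // properEneq nst2.
    rewrite -addnS leq_add ?leq_sub2l // ltn_sub2l //.
    exact: leq_trans lt (max_card _).
  have lt : i < j.
    by rewrite ltn_neqAle ij andbT; apply: contraNneq nst => /val_inj ->; rewrite Est.
  rewrite -addSn leq_add ?Est // ltn_sub2l //.
  by rewrite -ltnS; apply: leq_trans (ltn_ord j); rewrite ltnS.
exists sel; split=> [x|x y xy].
  (* Every neighbour of [x] is [hidden_of x a] for some gadget [a], which bounds the degree. *)
  pose f a : bip_graph (tree_inc sel) := inr (hidden_of x a).
  have -> : k.+1 * #|{set K}| = #|[set: gadget]| by rewrite cardsT card_prod card_ord.
  apply: leq_trans (leq_imset_card f _); apply/subset_leq_card/subsetP => -[z|h];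
    rewrite inE //= => /and3P[/eqP E _ _].
  by apply/imsetP; exists (gadget_in h); [rewrite inE|exact: congr1 E].
rewrite -(adj_label_gadget xy) -selP; congr (odd _).
have inj : injective (fun a => inr (hidden_of x a) : bip_graph (tree_inc sel)).
  by move=> [i s] [j t] [_ -> ->].
rewrite -(card_imset _ inj); apply: eq_card => v.
apply/imsetP/idP => [[a]|].
  rewrite inE /le val_gadget_of => /andP[/andP[Da ca] sa] ->.
  rewrite !inE /= tree_inc_common; case: a => i s in Da ca sa *.
  by rewrite /hidden_of /gadget_in /= eqxx Da ca.
rewrite !inE; case: v => // h /=; rewrite tree_inc_common => /and4P[/eqP E Dh ch sh].
exists (gadget_in h); last exact: congr1 E.
by rewrite inE /le val_gadget_of Dh ch sh.
Qed.

Lemma tree_model_lacon : exists label (pi : bip_graph (tree_inc predT) -> nat),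
  lacon_decomposition label pi /\ wcol_infty pi <= k.+1 * #|{set K}|.+1.
Proof.
(* Larger balls come first, then larger colour sets, and the target vertices last; the factor
   [#|K|.+1] makes the order lexicographic. *)
pose key (v : bip_graph (tree_inc predT)) :=
  if v is inr h then (k - (gadget_in h).1) * #|K|.+1 + (#|K| - #|h.2|)
  else k.+1 * #|K|.+1.
have [pi pi_inj pi_mono] := injective_refinement key.
have pi_target x h : pi (inr h) < pi (inl x).
  apply: pi_mono => /=; apply: (@leq_trans ((k - (val h.1).2).+1 * #|K|.+1)).
    by rewrite mulSnr -addnS leq_add2l ltnS leq_subr.
  by rewrite leq_mul2r ltnS leq_subr orbT.
have pi_level (h h' : hidden) :
    (gadget_in h').1 < (gadget_in h).1 -> pi (inr h) < pi (inr h').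
  move=> lt; apply: pi_mono; rewrite /key.
  have := ltn_ord (gadget_in h).1 => lek.
  apply: leq_trans (leq_addr _ _).
  apply: (@leq_trans ((k - (gadget_in h).1).+1 * #|K|.+1)).
    by rewrite mulSnr -addnS leq_add2l ltnS leq_subr.
  by rewrite leq_mul2r; apply/orP; right; lia.
exists (fun h => adj_label (gadget_in h)), pi; split; last exact: tree_inc_wcol.
have common x y : (inr (hidden_of x (gadget_of x y)) : bip_graph (tree_inc predT))
    \in nbr (inl x : bip_graph (tree_inc predT)) :&: nbr (inl y : bip_graph (tree_inc predT)).
  by rewrite !inE /= tree_inc_common eqxx val_gadget_of leqnn subxx.
split=> // [x y|x y xy h [hxy hmax]].
  by apply/set0Pn; exists (inr (hidden_of x (gadget_of x y))); apply: common.
rewrite -(adj_label_gadget xy); congr adj_label; apply/esym.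
move: hxy; rewrite !inE /= tree_inc_common => /and4P[_ Dh ch _].
(* A larger radius, or at equal radius a proper superset of the colours, would put [h] before the
   common neighbour with gadget [gadget_of x y]; so [h] has this gadget. *)
have le0 := hmax _ (common x y).
have Elv : (gadget_in h).1 = (gadget_of x y).1.
  apply/val_inj/eqP => /=; rewrite eqn_leq; apply/andP; split; last first.
    by rewrite -[leqLHS]/(nat_of_ord (gadget_of x y).1) val_gadget_of.
  rewrite leqNgt; apply/negP => lt; move: le0; rewrite leqNgt pi_level //.
rewrite /gadget_in /gadget_of; congr (_, _); first exact: Elv.
apply/eqP; rewrite eqEsubset ch andbT.
apply: contraTT le0 => nsub; rewrite -ltnNge; apply: pi_mono.
have := proper_card (_ : [set c x; c y] \proper h.2); rewrite properE ch nsub => /(_ isT).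
by have := max_card h.2; rewrite /key Elv /=; lia.
Qed.

End TreeModel.

(** * Shrub-decompositions from tree models *)

Fixpoint walk (T : finType) (e : rel T) (n : nat) (x y : T) : bool :=
  if n is n'.+1 then [exists z, e x z && walk e n' z y] else x == y.

Lemma walkP (T : finType) (e : rel T) n x y :
  reflect (exists p, [/\ path e x p, last x p = y & size p = n]) (walk e n x y).
Proof.
elim: n x => [|n IHn] x /=.
  by apply: (iffP eqP) => [<-|[[|z p] [_ /= lp]]] //; exists [::].
apply: (iffP existsP) => [[z /andP[xz /IHn[p [pp lp sp]]]]|[[|z p] []//= /andP[xz pp] lp [sp]]].
  by exists (z :: p); rewrite /= xz pp lp sp.
by exists z; rewrite xz; apply/IHn; exists p.
Qed.

Lemma walk_cat (T : finType) (e : rel T) m n x y z :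
  walk e m x y -> walk e n y z -> walk e (m + n) x z.
Proof.
move=> /walkP[p [pp <- <-]] /walkP[q [pq <- <-]]; apply/walkP; exists (p ++ q).
by rewrite cat_path last_cat size_cat pp.
Qed.

Lemma walk_sym (T : finType) (e : rel T) n x y :
  symmetric e -> walk e n x y -> walk e n y x.
Proof.
move=> e_sym; elim: n x => [|n IHn] x /=; first by rewrite eq_sym.
case/existsP=> z /andP[xz /IHn yz]; have := walk_cat yz (_ : walk e 1 z x); rewrite addn1; apply.
by apply/existsP; exists x; rewrite e_sym xz /=.
Qed.

(** A walk shortens to a path, so the distance is also the least length of a walk. *)
Lemma is_distP (G : sgraph) (x y : G) l :
  is_dist x y l <-> walk (@adj G) l x y /\ forall n, walk (@adj G) n x y -> l <= n.
Proof.
have pathw p : is_path x y p -> walk (@adj G) (size p) x y.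
  by case/and3P=> pp /eqP lp _; apply/walkP; exists p.
have wpath n : walk (@adj G) n x y -> exists2 p, is_path x y p & size p <= n.
  case/walkP=> p [pp lp <-]; case/shortenP: pp lp => q pq uq qp lq.
  exists q; first by rewrite /is_path pq lq eqxx uq.
  by apply: uniq_leq_size qp; case/andP: uq.
split=> [[[p pp <-] lmin]|[lw lmin]]; split.
- exact: pathw.
- by move=> n /wpath[q pq]; apply: leq_trans; apply: lmin.
- have [p pp pl] := wpath _ lw; exists p => //.
  by apply/eqP; rewrite eqn_leq pl lmin ?pathw.
- by move=> p /pathw; apply: lmin.
Qed.

Lemma walk_dist (G : sgraph) (x y : G) n :
  walk (@adj G) n x y -> exists2 l, l <= n & is_dist x y l.
Proof.
move=> w; have ex : exists l, walk (@adj G) l x y by exists n.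
case: (ex_minnP ex) => l lw lmin; exists l; first exact: lmin.
exact/is_distP.
Qed.

(** As [f] grows by at most one along an edge, every walk from [x] to [y] has length at least [f y];
    the given walk attains this. *)
Lemma dist_potential (G : sgraph) (f : G -> nat) (x y : G) l :
  (forall u v, adj u v -> f v <= (f u).+1) -> f x = 0 ->
  walk (@adj G) (f y) x y -> is_dist x y l -> l = f y.
Proof.
move=> lip f0 w /is_distP[lw lmin]; apply/eqP; rewrite eqn_leq lmin //=.
suff : f y <= f x + l by rewrite f0.
elim: l x lw {w lmin f0} => [|l IHl] x /=; first by move/eqP->; rewrite addn0.
case/existsP=> z /andP[/lip xz /IHl]; lia.
Qed.

Lemma sum_exp2_inj i j i' j' : 2 ^ i + 2 ^ j = 2 ^ i' + 2 ^ j' ->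
  (i = i' /\ j = j') \/ (i = j' /\ j = i').
Proof.
have sorted a b a' b' : a <= b -> a' <= b' -> 2 ^ a + 2 ^ b = 2 ^ a' + 2 ^ b' ->
    a = a' /\ b = b'.
  (* If [d < d'], then [2 ^ c + 2 ^ d <= 2 ^ d'], which is too small. *)
  have top c d c' d' : c <= d -> 2 ^ c + 2 ^ d = 2 ^ c' + 2 ^ d' -> d' <= d.
    move=> cd E; rewrite leqNgt; apply/negP => dd'.
    have := leq_pexp2l (isT : 0 < 2) cd; have := leq_pexp2l (isT : 0 < 2) dd'.
    by rewrite expnS; have := expn_gt0 2 c'; lia.
  move=> ab ab' E; have Eb : b = b'.
    by have := top _ _ _ _ ab E; have := top _ _ _ _ ab' (esym E); lia.
  by split=> //; apply: (@expnI 2) => //; rewrite Eb in E; lia.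
have [ij|/ltnW ij] := leqP i j; have [ij'|/ltnW ij'] := leqP i' j' => E.
- by left; apply: sorted.
- by right; apply: sorted => //; rewrite [RHS]addnC.
- by right; rewrite addnC in E; have [] := sorted _ _ _ _ ij ij' E.
- by left; rewrite addnC [RHS]addnC in E; have [] := sorted _ _ _ _ ij ij' E.
Qed.

(** * The tree of balls with a private path below every point *)

Section ShrubTree.
Variables (G : sgraph) (k W : nat) (D : G -> G -> nat) (start : G -> nat).
Hypothesis D_um : ultrametric k D.
Hypothesis start_le : forall x, start x <= W.

(** [N] exceeds [W] and all values of the shifted ultrametric, so level [N] is one ball and contains
    no leaf. *)
Let N := W + k.+2.

(* Shifting the ultrametric by [W] makes room, below each ball of radius 0, for
   a private path from level [start x] to level [W]. *)
Let D' (x y : G) := if x == y then 0 else W + D x y.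

Let D'_um : ultrametric N D'.
Proof.
rewrite /D'; split=> [x y|x y|x y z|x y].
- by have [_|xy] := eqVneq x y; rewrite ?eqxx // addn_eq0 (um_eq0 D_um) (negPf xy) andbF.
- by rewrite eq_sym (um_sym D_um).
- case: (eqVneq x y) => [->|xy]; first by rewrite leq_max leqnn orbT.
  case: (eqVneq y z) => [<-|yz]; first by rewrite (negPf xy) leq_max leqnn.
  case: eqVneq => // xz; rewrite -addn_maxr leq_add2l.
  by case: D_um.
- by case: eqVneq => // _; have := um_bound D_um x y; rewrite /N; lia.
Qed.

Let rep := ball_rep D'.

Let rep_small x l : l <= W -> rep x l = x.
Proof.
move=> lW; have := ball_repP D'_um x l; rewrite -/(rep x l) {1}/D'.
case: eqVneq => // nx le; have := um_eq0 D_um x (rep x l).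
by rewrite (negPf nx) => /eqP; lia.
Qed.

Let start_rep x l : start x <= l -> start (rep x l) <= l.
Proof.
by have [/rep_small->//|/ltnW Wl _] := leqP l W; apply: leq_trans Wl.
Qed.

(* Level [N] is a triangle, so that the root does not have degree one. *)
Let valid (x : G) (l : nat) (i : 'I_3) := (start x <= l) && ((i == ord0) || (l == N)).

Let node : finType :=
  {v : G * 'I_N.+1 * 'I_3 | (v.1.1 == rep v.1.1 v.1.2) && valid v.1.1 v.1.2 v.2}.

Let pt (v : node) : G := (val v).1.1.
Let lv (v : node) : nat := (val v).1.2.
Let ix (v : node) : 'I_3 := (val v).2.

Let node_ext u v : pt u = pt v -> lv u = lv v -> ix u = ix v -> u = v.
Proof.
rewrite /pt /lv /ix => Ep El Ei; apply/val_inj.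
case: (val u) (val v) Ep El Ei => [[x l] i] [[y l'] j] /= -> El ->.
by congr (_, _, _); apply: val_inj.
Qed.

Let pt_canonical v : pt v = rep (pt v) (lv v).
Proof. by case/andP: (valP v) => /eqP. Qed.

Let lv_bound v : lv v <= N. Proof. by rewrite -ltnS /lv. Qed.

Let start_lv v : start (pt v) <= lv v.
Proof. by case/and3P: (valP v). Qed.

Let ix0 v : lv v < N -> ix v = ord0.
Proof.
by case/and3P: (valP v) => _ _ /orP[/eqP//|/eqP E]; rewrite /lv E ltnn.
Qed.

Let node_ex x l i : start x <= l <= N -> (i == ord0) || (l == N) ->
  exists v, [/\ pt v = rep x l, lv v = l & ix v = i].
Proof.
move=> /andP[sl lN] il; have lN1 : l < N.+1 by [].
have ok : (rep x l == rep (rep x l) l) && valid (rep x l) l i.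
  by rewrite /rep (ball_rep_id D'_um) eqxx /valid start_rep.
by exists (Sub (rep x l, Ordinal lN1, i) ok); split.
Qed.

Let up u v := (lv v == (lv u).+1) && (pt v == rep (pt u) (lv v)).

Let shrub_adj u v :=
  [|| up u v, up v u | [&& lv u == N, lv v == N & ix u != ix v]].

Let shrub_sym : symmetric shrub_adj.
Proof. by move=> u v; rewrite /shrub_adj orbCA andbCA [ix u == _]eq_sym. Qed.

Let shrub_irr : irreflexive shrub_adj.
Proof. by move=> u; rewrite /shrub_adj /up eqxx !andbF orbF /=; lia. Qed.

Definition shrub_tree := SGraph shrub_sym shrub_irr.

Let root_pt u v : lv u = N -> lv v = N -> pt u = pt v.
Proof.
move=> uN vN; rewrite (pt_canonical u) (pt_canonical v) uN vN; apply/eqP.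
by rewrite (ball_rep_eq D'_um) (um_bound D'_um).
Qed.

Lemma shrub_tree_treedepth : treedepth shrub_tree <= N.+1 * 3.
Proof.
apply: (@ball_order_treedepth _ _ _ D'_um shrub_tree pt lv) => // [x l|u v].
  rewrite -[leqRHS](card_ord 3) -(card_in_imset (f := ix)) ?max_card //.
  move=> u v; rewrite !inE => /andP[/eqP pu /eqP lu] /andP[/eqP pv /eqP lv'] E.
  by apply: node_ext E; rewrite ?pu ?lu.
rewrite /ball_le => /or3P[/andP[/eqP-> ->]|/andP[/eqP-> ->]|].
- by rewrite leqnSn orbT.
- by rewrite leqnSn.
- case/and3P=> /eqP uN /eqP vN _.
  by rewrite uN vN leqnn {1}(pt_canonical u) uN (root_pt uN vN) eqxx.
Qed.

(** The last step up reaches every index at once, so only the empty walk needs equal indices. *)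
Let walk_up n u v : lv v = lv u + n -> pt v = rep (pt u) (lv v) ->
  (n = 0 -> ix u = ix v) -> walk (@adj shrub_tree) n u v.
Proof.
elim: n u => [|n IHn] u lvu pvu ixE /=.
  rewrite addn0 in lvu; apply/eqP/node_ext; rewrite ?ixE // pvu lvu.
  exact: pt_canonical.
have [n0|n0] := posnP n.
  by apply/existsP; exists v; rewrite n0 /= /shrub_adj /up pvu lvu n0 addn1 !eqxx.
have [||w [pw lw iw]] := @node_ex (pt u) (lv u).+1 ord0.
- by have := start_lv u; have := lv_bound v; lia.
- by rewrite eqxx.
apply/existsP; exists w; rewrite /= /shrub_adj /up {1}lw {1}pw lw !eqxx /=.
apply: IHn; [lia| |lia]; rewrite pw pvu /rep (ball_rep_nest D'_um) //; lia.
Qed.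

(** Every node is within [N.+1] of a fixed top node. Twice this is relaxed to the treedepth bound,
    so that one constant serves both. *)
Lemma shrub_tree_diameter (u v : shrub_tree) :
  exists2 l, l <= N.+1 * 3 & is_dist u v l.
Proof.
have sN x : start x <= N by have := start_le x; rewrite /N; lia.
have [||r [pr lr ir]] := @node_ex (pt u) N ord0; rewrite ?sN ?leqnn ?eqxx //.
have to_root w : exists2 n, n <= N.+1 & walk (@adj shrub_tree) n w r.
  have [wN|] := ltnP (lv w) N.
    exists (N - lv w); first lia.
    apply: walk_up; rewrite ?lr; [have := lv_bound w; lia| |lia].
    rewrite pr; apply/eqP; rewrite /rep (ball_rep_eq D'_um); exact: um_bound.
  have := lv_bound w => wN wN'; have {wN wN'} wN : lv w = N by lia.
  have [E|nE] := eqVneq (ix w) (ix r).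
    by exists 0 => //; apply/eqP/node_ext; rewrite ?wN ?lr //; apply: root_pt.
  exists 1 => //; apply/existsP; exists r.
  by rewrite /= /shrub_adj wN lr nE !eqxx !orbT.
have [m mN mw] := to_root u; have [n nN nw] := to_root v.
have [l ln ld] := walk_dist (walk_cat mw (walk_sym (@adj_sym shrub_tree) nw)).
exists l => //; lia.
Qed.

Let leaf_ex x : exists v, [&& pt v == x, lv v == start x & ix v == ord0].
Proof.
have [||v [pv lv' iv]] := @node_ex x (start x) ord0; rewrite ?eqxx //.
  by rewrite leqnn; have := start_le x; rewrite /N; lia.
by exists v; rewrite pv lv' iv !eqxx andbT /= rep_small ?eqxx.
Qed.

Definition shrub_leaf (x : G) : shrub_tree := xchoose (leaf_ex x).

Let leaf_pt x : pt (shrub_leaf x) = x.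
Proof. by case/and3P: (xchooseP (leaf_ex x)) => /eqP. Qed.

Let leaf_lv x : lv (shrub_leaf x) = start x.
Proof. by case/and3P: (xchooseP (leaf_ex x)) => _ /eqP. Qed.

Lemma shrub_leaf_inj : injective shrub_leaf.
Proof. by move=> x y E; rewrite -(leaf_pt x) E leaf_pt. Qed.

(** A leaf sees only its parent, as its path is private and ends at level [start x]. Any other node
    has a neighbour one level below and another at its own level or above. *)
Lemma shrub_leafP (v : shrub_tree) : #|nbr v| = 1 <-> exists x, shrub_leaf x = v.
Proof.
split=> [/eqP/cards1P[w nv]|[x <-]]; last first.
  have [||w [pw lw iw]] := @node_ex x (start x).+1 ord0; rewrite ?eqxx //.
    by rewrite leqnSn; have := start_le x; rewrite /N; lia.
  apply/eqP/cards1P; exists w; apply/setP => u; rewrite !inE.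
  apply/idP/eqP => [|->]; last first.
    by rewrite /= /shrub_adj /up leaf_lv leaf_pt pw lw !eqxx.
  rewrite /= /shrub_adj /up leaf_lv leaf_pt.
  case/or3P=> [/andP[/eqP lu /eqP pu]|/andP[/eqP lu /eqP pu]|].
  - apply: node_ext; rewrite ?lw ?pw ?lu // ?pu ?lu //.
    by rewrite iw ix0 // lu; have := start_le x; rewrite /N; lia.
  - move: pu; rewrite rep_small // => pu.
    by have := start_lv u; rewrite -pu; lia.
  - by case/and3P=> /eqP; have := start_le x; rewrite /N; lia.
have [lvE|ltv] : lv v = start (pt v) \/ start (pt v) < lv v.
- by have := start_lv v; rewrite leq_eqVlt => /orP[/eqP->|]; [left|right].
- exists (pt v); apply: node_ext; rewrite ?leaf_pt ?leaf_lv // !ix0 ?leaf_lv -?lvE //;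
    by have := start_le (pt v); rewrite lvE /N; lia.
have [||u [pu lu iu]] := @node_ex (pt v) (lv v).-1 ord0; rewrite ?eqxx //.
  by have := lv_bound v; lia.
have uw : u = w.
  apply/set1P; rewrite -nv inE /= /shrub_adj; apply/or3P/Or32; rewrite /up lu pu.
  rewrite /rep (ball_rep_nest D'_um) ?leq_pred // -/(rep (pt v) (lv v)).
  by rewrite -pt_canonical eqxx andbT; lia.
have [w' [w'v lw']] : exists w', shrub_adj v w' /\ lv v <= lv w'; last first.
  have : w' \in [set w] by rewrite -nv inE.
  by move/set1P => E; move: lw'; rewrite E -uw lu; lia.
have [vN|] := ltnP (lv v) N.
  have [||w' [pw lw iw]] := @node_ex (pt v) (lv v).+1 ord0; rewrite ?eqxx //.
    by rewrite vN andbT; lia.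
  by exists w'; rewrite /shrub_adj /up lw pw !eqxx.
have := lv_bound v => vN vN'; have {vN vN'} vN : lv v = N by lia.
pose j : 'I_3 := if ix v == ord0 then ord_max else ord0.
have [||w' [pw lw iw]] := @node_ex (pt v) N j; rewrite ?eqxx ?orbT //.
  by rewrite leqnn andbT -vN; apply: start_lv.
exists w'; rewrite lw vN /shrub_adj vN lw iw !eqxx; split=> //.
by rewrite /j; have [->|nj] := eqVneq (ix v) ord0; rewrite ?nj ?orbT.
Qed.

Lemma shrub_leaf_dist x y l : is_dist (shrub_leaf x) (shrub_leaf y) l ->
  l = if x == y then 0 else (D x y).*2 + (W - start x) + (W - start y).
Proof.
(* [m v] is the level where the branches of [x] and [v] meet, and [f v] is the length of the route
   from the leaf of [x] to [v] through that level. *)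
pose m (v : shrub_tree) := maxn (lv v) (D' x (pt v)).
pose f (v : shrub_tree) := (m v - start x) + (m v - lv v).
have lip u v : adj u v -> f v <= (f u).+1.
  have st w : start x <= m w.
    rewrite /m /D'; have := start_le x; have := start_lv w.
    by case: eqVneq => [->|_]; lia.
  have step u' v' : up u' v' -> f v' <= (f u').+1 /\ f u' <= (f v').+1.
    case/andP=> /eqP lv' /eqP pv; have := st u'; have := st v'; rewrite /f /m.
    case: D'_um => _ _ tri _.
    have : D' (pt u') (pt v') <= lv v' by rewrite pv; apply: (ball_repP D'_um).
    have := tri x (pt u') (pt v'); have := tri x (pt v') (pt u').
    by rewrite (um_sym D'_um (pt v')); lia.
  case/or3P=> [/step[]//|/step[]//|/and3P[/eqP uN /eqP vN _]].
  by rewrite /f /m (root_pt uN vN) uN vN.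
have fx : f (shrub_leaf x) = 0.
  by rewrite /f /m leaf_pt leaf_lv (um_refl D'_um) maxn0 subnn.
have fy : f (shrub_leaf y) = if x == y then 0 else (D x y).*2 + (W - start x) + (W - start y).
  case: eqVneq => [<-//|xy]; rewrite /f /m leaf_pt leaf_lv /D' (negPf xy).
  by have := start_le x; have := start_le y; lia.
rewrite -fy; apply: dist_potential lip fx _; rewrite fy.
case: eqVneq => [->|xy] /=; first exact: eqxx.
have D'E : D' x y = W + D x y by rewrite /D' (negPf xy).
have D0 : 0 < D x y by rewrite lt0n (um_eq0 D_um).
have [||w [pw lw iw]] := @node_ex x (D' x y) ord0; rewrite ?eqxx //.
  by rewrite (um_bound D'_um) D'E andbT; have := start_le x; lia.
have climb z : D' z x <= D' x y ->
    walk (@adj shrub_tree) (D x y + (W - start z)) (shrub_leaf z) w.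
  move=> zx; have := start_le z => sz; apply: walk_up; rewrite ?leaf_lv ?leaf_pt ?lw; [lia| |lia].
  by rewrite pw; apply/eqP; rewrite eq_sym /rep (ball_rep_eq D'_um).
have := walk_cat (climb x _) (walk_sym (@adj_sym shrub_tree) (climb y _)).
rewrite (um_refl D'_um) (um_sym D'_um y) => /(_ isT (leqnn _)); congr walk; lia.
Qed.

End ShrubTree.

Lemma tree_models_shrub (C : graph_class) :
  has_tree_models C -> bounded_shrub_decompositions C.
Proof.
case=> k [K [R modelC]].
(* [M] exceeds twice every distance, so [len q a b] modulo [M] yields [q], and the quotient is a sum
   of two powers of two that yields the unordered pair of colours. *)
pose M := k.+1.*2.
pose tau (a : K) := M * 2 ^ enum_rank a.
pose W := M * 2 ^ #|K|.
pose d := (W + k.+2).+1 * 3.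
pose len (q : nat) (a b : K) := q.*2 + tau a + tau b.
have tauW a : tau a <= W by rewrite leq_mul2l leq_exp2l // ltnW ?orbT.
have len_inj q q' a b a' b' : q <= k -> q' <= k -> len q a b = len q' a' b' ->
    q = q' /\ ((a = a' /\ b = b') \/ (a = b' /\ b = a')).
  move=> qk qk' E.
  have {}E : (2 ^ enum_rank a + 2 ^ enum_rank b) * M + q.*2 =
             (2 ^ enum_rank a' + 2 ^ enum_rank b') * M + q'.*2.
    by move: E; rewrite /len /tau !mulnDl ![M * _]mulnC; lia.
  have Eq : q = q'.
    have := congr1 (modn^~ M) E; rewrite /= !modnMDl !modn_small /M ?ltn_double ?ltnS //.
    exact: double_inj.
  split=> //; rewrite Eq in E; move/addIn/eqP: E; rewrite eqn_pmul2r /M // => /eqP.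
  by case/sum_exp2_inj=> -[/val_inj/enum_rank_inj-> /val_inj/enum_rank_inj->]; [left|right].
pose rel_S (i j : 'I_1) l := [&& 1 <= l, l <= d &
  [exists q : 'I_k.+1, exists a, exists b, (l == len q a b) && R q a b]].
have S_bound i j l : rel_S i j l -> 1 <= l <= d by case/and3P=> -> ->.
exists d, (@Signature 1 d rel_S S_bound (fun i j l => erefl)) => G /modelC[D [c [D_um adjR]]].
pose start x := W - tau (c x).
have startW x : start x <= W by apply: leq_subr.
exists (shrub_tree k W D start), (shrub_leaf D_um startW), (fun _ => ord0).
split; last exact: shrub_tree_treedepth.
split.
- exact: shrub_tree_diameter.
- exact: shrub_leaf_inj.
- exact: shrub_leafP.
move=> u v l uvl; rewrite /= /rel_S; have := shrub_leaf_dist uvl.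
case: eqVneq => [-> ->|uv El]; first by rewrite adj_irr.
have {}El : l = len (D u v) (c u) (c v) by rewrite El /start !subKn.
have Duv : D u v < k.+1 by rewrite ltnS (um_bound D_um).
have -> : 0 < l.
  by rewrite El /len; have := um_eq0 D_um u v; rewrite (negPf uv); lia.
have -> : l <= d.
  have [l' l'd] := shrub_tree_diameter D_um startW
    (shrub_leaf D_um startW u) (shrub_leaf D_um startW v).
  by move/shrub_leaf_dist; rewrite -(shrub_leaf_dist uvl) => <-.
apply/idP/existsP => [auv|[q /existsP[a /existsP[b /andP[/eqP E Rab]]]]].
  exists (Ordinal Duv); apply/existsP; exists (c u); apply/existsP; exists (c v).
  by rewrite /= El eqxx -adjR.
move: Rab; rewrite El in E; have [||<- [][<- <-]] := len_inj _ _ _ _ _ _ _ _ E.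
- by rewrite -ltnS.
- by rewrite -ltnS.
- by rewrite -adjR.
- by rewrite (um_sym D_um) -adjR 1?eq_sym // adj_sym.
Qed.

(** * Tree models of transductions *)

Lemma env_cons0 (U : Type) n (x : U) (s : 'I_n -> U) : env_cons x s ord0 = x.
Proof. by rewrite /env_cons unlift_none. Qed.

Lemma env_consS (U : Type) n (x : U) (s : 'I_n -> U) i :
  env_cons x s (lift ord0 i) = s i.
Proof. by rewrite /env_cons liftK. Qed.

Lemma env_cons2 (U : Type) (x y : U) (i : 'I_2) :
  env_cons x (env_cons y (@env_nil U)) i = if i == ord0 then x else y.
Proof.
case: (unliftP ord0 i) => [j|] ->; last by rewrite env_cons0.
by rewrite env_consS (ord1 j) env_cons0.
Qed.

Lemma leq_card_imset_kernel (I T T' : finType) (A : {set I}) (f : I -> T) (f' : I -> T') :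
  {in A &, forall i j, f i = f j -> f' i = f' j} -> #|f' @: A| <= #|f @: A|.
Proof.
move=> ff'; pose h y := omap f' [pick i in A | f i == y].
rewrite -(card_imset _ (@Some_inj _ : injective (@Some T'))); apply: leq_trans (leq_imset_card h _).
apply/subset_leq_card/subsetP => _ /imsetP[_ /imsetP[i Ai ->] ->].
apply/imsetP; exists (f i); first exact: imset_f.
rewrite /h; case: pickP => [j /andP[Aj /eqP fj]|/(_ i)]; last by rewrite Ai eqxx.
by rewrite /= (ff' j i).
Qed.

(** * Extension of tuples in a coloured ultrametric space *)

Section TypeExtension.
Variables (T : finType) (k : nat) (D : T -> T -> nat) (K : finType) (c : T -> K).
Variable n : nat.
Hypothesis D_um : ultrametric k D.

Let near_color (x : T) (l : nat) (a : K) := [exists z, (D x z <= l) && (c z == a)].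

Let subballs (x : T) (l : nat) (a : K) :=
  [set ball_rep D z l.-1 | z in [set z | (D x z <= l) && (c z == a)]].

(** Truncating the count at [n.+1] is harmless, since [n] points meet at most [n] child balls. The
    flag tells whether the child ball around [x] itself contains the colour. *)
Definition ball_census (x : T) : {ffun 'I_k.+1 * K -> 'I_n.+2 * bool} :=
  [ffun la : 'I_k.+1 * K => (inord (minn n.+1 #|subballs x la.1 la.2|), near_color x la.1.-1 la.2)].

Let ball_census_near x x' l a : l <= k -> ball_census x = ball_census x' ->
  near_color x l.-1 a = near_color x' l.-1 a.
Proof.
by move=> lk /ffunP/(_ (inord l, a)); rewrite !ffunE /= inordK // => -[].
Qed.

Let ball_census_card x x' l a : l <= k -> ball_census x = ball_census x' ->
  minn n.+1 #|subballs x l a| = minn n.+1 #|subballs x' l a|.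
Proof.
move=> lk /ffunP/(_ (inord l, a)); rewrite !ffunE /= inordK // => -[/(congr1 val) + _].
by rewrite /= !inordK // ltnS geq_minl.
Qed.

(* Seen from the nearest point [s j], the new point [x] lies in a child of a
   ball around [s j] that contains no [s i]. Comparing the number of children
   containing the colour of [x] with the number of those that meet [s] shows
   that the same ball around [s' j] has such a child as well. *)
Lemma extend_tuple (s s' : 'I_n -> T) (x : T) :
  (forall i, c (s i) = c (s' i)) ->
  (forall i, ball_census (s i) = ball_census (s' i)) ->
  (forall i j, D (s i) (s j) = D (s' i) (s' j)) ->
  exists2 x', c x' = c x & forall i, D x' (s' i) = D x (s i).
Proof.
move=> Ec Et ED.
case: (pickP 'I_n) => [n0 _|j0]; last first.
  by exists x => // i; have := j0 i.
case: (arg_minnP (fun i => D x (s i)) (isT : xpredT n0)) => j _ jmin.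
set q := D x (s j) in jmin *.
have [/eqP q0|q0] := posnP q.
  rewrite (um_eq0 D_um) in q0; rewrite (eqP q0).
  by exists (s' j); rewrite ?Ec.
have qk : q <= k by apply: (um_bound D_um).
(* The exact distances from such an [x'] to all [s' i] then follow from the isosceles property. *)
suff [x' [cx' x'j x'i]] : exists x', [/\ c x' = c x, D (s' j) x' <= q &
    forall i, q <= D x' (s' i)].
  exists x' => // i.
  have Eq : D x' (s' j) = q by apply/eqP; rewrite eqn_leq x'i (um_sym D_um) // x'j.
  rewrite (um_isosceles D_um (y := s' j)) ?Eq ?x'i // -ED.
  by rewrite [RHS](um_isosceles D_um (y := s j)) ?jmin.
apply: contrapT => no.
pose I t : {set 'I_n} := [set i | (D (t j) (t i) <= q) && near_color (t i) q.-1 (c x)].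
pose img t := [set ball_rep D (t i) q.-1 | i in I t].
have EI : I s' = I s.
  by apply/setP => i; rewrite !inE -ED (ball_census_near _ qk (Et i)).
(* If there is no such [x'], every child ball around [s' j] that contains the colour also contains
   some [s' i]. *)
have sub' : subballs (s' j) q (c x) \subset img s'.
  apply/subsetP => _ /imsetP[z + ->]; rewrite inE => /andP[zq /eqP cz].
  have [i zi] : exists i, D z (s' i) < q.
    apply: contrapT => far; apply: no; exists z; split=> // i.
    by rewrite leqNgt; apply/negP => lt; apply: far; exists i.
  have zi' : D z (s' i) <= q.-1 by rewrite -ltnS prednK.
  apply/imsetP; exists i; last by apply/eqP; rewrite (ball_rep_eq D_um).
  rewrite inE (um_tri D_um zq) 1?ltnW //; apply/existsP; exists z.
  by rewrite cz eqxx (um_sym D_um) // zi'.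
have imgE : #|img s'| <= #|img s|.
  rewrite /img EI; apply: leq_card_imset_kernel => i i' _ _ /eqP.
  by rewrite (ball_rep_eq D_um) ED -(ball_rep_eq D_um) => /eqP.
have imgn : #|img s| <= n.
  apply: leq_trans (leq_imset_card _ _) _; apply: leq_trans (max_card _) _.
  by rewrite card_ord.
(* Around [s j], the child ball of [x] comes in addition to [img s]. As [img s] has at most [n]
   elements, the truncated counts would differ. *)
have sub : ball_rep D x q.-1 |: img s \subset subballs (s j) q (c x).
  rewrite subUset sub1set; apply/andP; split.
    by apply/imsetP; exists x; rewrite // inE eqxx (um_sym D_um) // leqnn.
  apply/subsetP => _ /imsetP[i + ->]; rewrite inE => /andP[iq /existsP[z /andP[zq cz]]].
  apply/imsetP; exists z; last by apply/eqP; rewrite (ball_rep_eq D_um).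
  by rewrite inE cz (um_tri D_um iq) // (leq_trans zq) // leq_pred.
have xnew : ball_rep D x q.-1 \notin img s.
  apply/imsetP => -[i _ /eqP]; rewrite (ball_rep_eq D_um).
  by have := jmin i isT; rewrite -/q; lia.
have := ball_census_card (c x) qk (Et j).
have := subset_leq_card sub; have := subset_leq_card sub'.
by rewrite cardsU1 xnew; lia.
Qed.

End TypeExtension.

Section Determined.
Variables p m : nat.

Definition atoms_determined (U : fo_structure p m) (D : U -> U -> nat)
    (K : finType) (c : U -> K) : Prop :=
  [/\ forall x y x' y', c x = c x' -> c y = c y' -> D x y = D x' y' ->
        fo_adj x y = fo_adj x' y' /\ fo_sim x y = fo_sim x' y',
      forall i x x', c x = c x' -> fo_param i x = fo_param i x' &
      forall i x x', c x = c x' -> fo_copy i x = fo_copy i x'].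

Definition formula_determined (U : fo_structure p m) (D : U -> U -> nat)
    (K : finType) (c : U -> K) (n : nat) (phi : formula p m n) : Prop :=
  forall s s' : 'I_n -> U, (forall i, c (s i) = c (s' i)) ->
    (forall i j, D (s i) (s j) = D (s' i) (s' j)) -> sat phi s = sat phi s'.

(** The palette [K] is fixed before the structure, hence uniform over the class. A quantifier adds
    the census to the colour, and [extend_tuple] transports the witness. *)
Lemma formulas_determined (k : nat) (K0 : finType) (n : nat) (phi : formula p m n) :
  exists K : finType, forall (U : fo_structure p m) (D : U -> U -> nat) (c0 : U -> K0),
    ultrametric k D -> atoms_determined D c0 ->
    exists c : U -> K, formula_determined D c phi.
Proof.
elim: phi => {n} [n|n i j|n i j|n i j|n a i|n a i|n g [K IHg]|n g [K IHg] h [K' IHh]|n g [K IHg]].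
- by exists K0 => U D c0 _ _; exists c0.
- exists K0 => U D c0 D_um _; exists c0 => s s' _ ED /=.
  by rewrite -!(um_eq0 D_um) ED.
- exists K0 => U D c0 _ [det _ _]; exists c0 => s s' Ec ED /=.
  by case: (det _ _ _ _ (Ec i) (Ec j) (ED i j)).
- exists K0 => U D c0 _ [det _ _]; exists c0 => s s' Ec ED /=.
  by case: (det _ _ _ _ (Ec i) (Ec j) (ED i j)).
- by exists K0 => U D c0 _ [_ det _]; exists c0 => s s' Ec ED /=; apply: det.
- by exists K0 => U D c0 _ [_ _ det]; exists c0 => s s' Ec ED /=; apply: det.
- exists K => U D c0 D_um at0; have [c cP] := IHg U D c0 D_um at0.
  by exists c => s s' Ec ED /=; rewrite (cP s s').
- exists (K * K')%type => U D c0 D_um at0.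
  have [c cP] := IHg U D c0 D_um at0; have [c' cP'] := IHh U D c0 D_um at0.
  exists (fun x => (c x, c' x)) => s s' Ec ED /=.
  by rewrite (cP s s') ?(cP' s s') // => i; case: (Ec i).
- exists (K * {ffun 'I_k.+1 * K -> 'I_n.+2 * bool})%type => U D c0 D_um at0.
  have [c cP] := IHg U D c0 D_um at0.
  exists (fun x => (c x, ball_census k D c n x)).
  suff half (s s' : 'I_n -> U) :
      (forall i, (c (s i), ball_census k D c n (s i)) =
                 (c (s' i), ball_census k D c n (s' i))) ->
      (forall i j, D (s i) (s j) = D (s' i) (s' j)) ->
      sat (FEx g) s -> sat (FEx g) s'.
    by move=> s s' Ec ED; apply/idP/idP; apply: half => // i; rewrite Ec.
  move=> Ec ED /= /existsP[x sx].
  have [||//|x' cx' Dx'] := @extend_tuple _ k D K c n D_um s s' x.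
  - by move=> i; case: (Ec i).
  - by move=> i; case: (Ec i).
  apply/existsP; exists x'; rewrite (cP _ (env_cons x s)) // => [i|i j].
    case: (unliftP ord0 i) => [i'|] ->; rewrite ?env_cons0 // !env_consS.
    by case: (Ec i').
  case: (unliftP ord0 i) => [i'|] ->; case: (unliftP ord0 j) => [j'|] ->;
    rewrite ?env_cons0 ?env_consS ?(um_refl D_um) //.
  by rewrite (um_sym D_um) Dx' (um_sym D_um).
Qed.

End Determined.

(** An ultrametric is an increasing chain of equivalence relations: [D x y] is the least [l] with
    [E l x y]. *)
Lemma chain_ultrametric (T : finType) (k : nat) (E : nat -> rel T) :
  (forall l, equivalence_rel (E l)) -> (forall x y, E 0 x y = (x == y)) ->
  (forall l, subrel (E l) (E l.+1)) -> (forall x y, E k x y) ->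
  exists2 D, ultrametric k D & forall x y l, (D x y <= l) = E l x y.
Proof.
move=> Eeq E0 Emono Ek.
have ex x y : exists l, E l x y by exists k.
pose D x y := ex_minn (ex x y).
have DE x y l : (D x y <= l) = E l x y.
  rewrite /D; case: ex_minnP => d Ed dmin; apply/idP/idP => [|/dmin//].
  by move/subnK <-; elim: (l - d) => // i; apply: Emono.
have Erefl l x : E l x x by case: (Eeq l x x x).
have Esym l x y : E l x y = E l y x.
  have H a b : E l a b -> E l b a.
    by move=> ab; case: (Eeq l a b a) => _ /(_ ab) <-.
  by apply/idP/idP; apply: H.
exists D => //; split=> [x y|x y|x y z|x y].
- by rewrite -leqn0 DE E0.
- by apply/eqP; rewrite eqn_leq !DE Esym -DE leqnn Esym -DE leqnn.
- set l := maxn _ _; rewrite DE.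
  have xy : E l x y by rewrite -DE leq_maxl.
  have yz : E l y z by rewrite -DE leq_maxr.
  by case: (Eeq l x y z) => _ ->.
- by rewrite DE.
Qed.

(** * Elimination forests as coloured ultrametric spaces *)

Section ForestModel.
Variables (G : sgraph) (k : nat) (parent : {ffun G -> option G}).
Hypothesis height : forest_height_le parent k.
Hypothesis edges : forall u v, adj u v -> ancestor parent u v || ancestor parent v u.

Let climb (i : nat) (v : G) := iter i (obind parent) (Some v).

Let climb_ex v : exists i, climb i v == None.
Proof. by exists k; apply: (forallP height). Qed.

Let depth v := ex_minn (climb_ex v).

Let climb_none v i : (climb i v == None) = (depth v <= i).
Proof.
rewrite /depth; case: ex_minnP => d d0 dmin; apply/idP/idP => [/dmin//|].
by move/subnK <-; rewrite /climb iterD -/(climb d v) (eqP d0); elim: (i - d) => //= j /eqP ->.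
Qed.

Let depth_le v : depth v <= k.
Proof. by rewrite -climb_none; apply: (forallP height). Qed.

Let depth_gt0 v : 0 < depth v.
Proof. by rewrite ltnNge -climb_none. Qed.

Let climb_add i j v u : climb j v = Some u -> climb i u = climb (i + j) v.
Proof. by rewrite /climb iterD -/(climb j v) => ->. Qed.

Let climb_depth j v u : climb j v = Some u -> depth u = depth v - j.
Proof.
move=> ju; have lt : j < depth v by rewrite ltnNge -climb_none ju.
have H i : (depth u <= i) = (depth v <= i + j) by rewrite -!climb_none (climb_add _ ju).
by have := H (depth v - j); have := H (depth u); lia.
Qed.

(* The ancestor of [v] at depth [t], counted from the root; [v] itself if [t]
   is too large, and [None] for [t = 0]. *)
Let anc (t : nat) (v : G) := climb (depth v - t) v.

Let anc_nest s t v w : s <= t -> anc t v = anc t w -> anc s v = anc s w.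
Proof.
move=> st; have via v' : anc s v' = obind (anc s) (anc t v').
  case E: (anc t v') => [u|] /=.
    rewrite [RHS](climb_add _ E) /anc (climb_depth E); congr climb; lia.
  move/eqP: E; rewrite climb_none => t0; apply/eqP; rewrite climb_none.
  by have := depth_gt0 v'; lia.
by rewrite !via => ->.
Qed.

Let anc_depth v : anc (depth v) v = Some v.
Proof. by rewrite /anc subnn. Qed.

Let ancestor_anc u v : ancestor parent u v -> anc (depth u) v = Some u.
Proof.
case/connectP=> q; elim: q v => [v _ ->|w q IHq v /= /andP[/eqP vw qw] lastu].
  exact: anc_depth.
have {}IHq := IHq w qw lastu.
have E : climb 1 v = Some w by rewrite /climb /= vw.
have lt : depth u <= depth w.
  by have := climb_depth IHq; lia.
rewrite -IHq /anc (climb_add _ E); congr climb.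
by have := climb_depth E; have := depth_gt0 w; lia.
Qed.

Let up_edge (t : nat) (v : G) := [exists u, (anc t v == Some u) && adj u v].

(** One end of an edge is the ancestor of the other at its own depth, and one bit per depth tells
    whether that ancestor is a neighbour. *)
Let adj_anc v w : adj v w =
  (anc (depth v) v == anc (depth v) w) && up_edge (depth v) w ||
  (anc (depth w) w == anc (depth w) v) && up_edge (depth w) v.
Proof.
apply/idP/idP => [vw|].
  have ok u u' : ancestor parent u u' -> adj u u' ->
      (anc (depth u) u == anc (depth u) u') && up_edge (depth u) u'.
    move/ancestor_anc => E uu'; rewrite anc_depth E eqxx.
    by apply/existsP; exists u; rewrite E eqxx.
  case/orP: (edges vw) => /ok; first by rewrite vw => ->.
  by rewrite adj_sym vw => ->; rewrite ?orbT.
have ok u u' : (anc (depth u) u == anc (depth u) u') && up_edge (depth u) u' -> adj u u'.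
  by rewrite anc_depth => /andP[/eqP E /existsP[z]]; rewrite -E => /andP[/eqP[->]].
by case/orP=> /ok //; rewrite adj_sym.
Qed.

Variables (p m : nat) (P : 'I_p -> pred G).

Let U := copy_structure m P.

(** Level 0 is equality of copies, level 1 equality of the underlying vertices, and level [k.+1]
    relates everything, as [anc 0] is [None]. *)
Let same_anc (l : nat) : rel U :=
  if l is l'.+1 then fun x y => anc (k - l') x.1 == anc (k - l') y.1 else eq_op.

Lemma forest_model :
  exists (D : U -> U -> nat)
    (c : U -> 'I_m * 'I_k.+1 * {ffun 'I_k.+1 -> bool} * {ffun 'I_p -> bool}),
    ultrametric k.+1 D /\ atoms_determined D c.
Proof.
have [||||D D_um DE] := @chain_ultrametric U k.+1 same_anc.
- case=> [|l] x y z /=; split=> //; first by move/eqP->.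
  by move/eqP->.
- by [].
- case=> [|l] x y /=; first by move/eqP->.
  by move/eqP/anc_nest => /(_ (k - l.+1)) H; apply/eqP/H; lia.
- by move=> x y /=; rewrite subnn; apply/eqP; rewrite /anc !subn0;
    rewrite (eqP (_ : climb _ _ == None)) ?climb_none // (eqP (_ : climb _ _ == None)) ?climb_none.
exists D, (fun x => (x.2, inord (depth x.1), [ffun t : 'I_k.+1 => up_edge t x.1],
  [ffun i => P i x.1])); split=> //; split.
- move=> x y x' y' [Ex2 Edx Eux _] [Ey2 Edy Euy _] ED.
  have depthE v v' : inord (depth v) = inord (depth v') :> 'I_k.+1 -> depth v = depth v'.
    by move/(congr1 val); rewrite /= !inordK // ltnS.
  have upE v v' t : t <= k -> [ffun t : 'I_k.+1 => up_edge t v] =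
      [ffun t : 'I_k.+1 => up_edge t v'] -> up_edge t v = up_edge t v'.
    by move=> tk /ffunP/(_ (inord t)); rewrite !ffunE inordK.
  have ancE t (u v : U) : t <= k -> (anc t u.1 == anc t v.1) = (D u v <= (k - t).+1).
    by move=> tk; rewrite DE /= subKn.
  have simE (u v : U) : (u.1 == v.1) = (D u v <= 1).
    rewrite DE /= subn0; apply/eqP/eqP => [->//|].
    have full w : anc k w = Some w by rewrite /anc (eqP (depth_le w)).
    by rewrite !full => -[].
  rewrite /= !simE ED; split=> //.
  rewrite Ex2 Ey2 !adj_anc; congr (_ && _).
  rewrite (depthE _ _ Edx) (depthE _ _ Edy) !ancE // (um_sym D_um y) (um_sym D_um y') ED.
  by rewrite (upE _ _ _ (depth_le x'.1) Euy) (upE _ _ _ (depth_le y'.1) Eux).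
- by move=> i x x' [_ _ _ /ffunP/(_ i)]; rewrite !ffunE.
- by move=> i x x' [E _ _ _]; rewrite /= E.
Qed.

End ForestModel.

(** Which distances and colours give an edge may vary with the graph, whereas [R] is fixed for the
    class. Hence each vertex carries the whole adjacency table of its graph in its colour, and [R]
    looks it up. *)
Lemma transduction_tree_models (C : graph_class) :
  structurally_bounded_treedepth C -> has_tree_models C.
Proof.
case=> C' [[p m chi nu phi] [[k tdk] transC]].
have [K KP] := formulas_determined k.+1
  ('I_m * 'I_k.+1 * {ffun 'I_k.+1 -> bool} * {ffun 'I_p -> bool})%type phi.
exists k.+1, (K * {ffun 'I_k.+2 * K * K -> bool})%type,
  (fun (l : nat) (a b : K * {ffun 'I_k.+2 * K * K -> bool}) =>
     a.2 (inord l, a.1, b.1)) => G /transC[F [/tdk tdF [P [_ [f f_bij fE]]]]].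
have /treedepth_leP/existsP[parent /andP[ht /forallP anc]] := tdF.
have edges (u v : F) : adj u v -> ancestor parent u v || ancestor parent v u.
  by have /forallP/(_ v)/implyP := anc u.
have [D [c0 [D_um at0]]] := forest_model ht edges m P.
have [c cP] := KP _ D c0 D_um at0.
pose emb (x : G) := val (f x).
have emb_inj : injective emb by move=> x y /val_inj; apply: (bij_inj f_bij).
pose DG x y := D (emb x) (emb y).
have adjE x y x' y' : x != y -> x' != y' -> c (emb x) = c (emb x') ->
    c (emb y) = c (emb y') -> DG x y = DG x' y' -> adj x y = adj x' y'.
  move=> xy xy' Ex Ey ED; rewrite -!fE /= /interp_adj !(inj_eq (bij_inj f_bij)) xy xy' /=.
  by congr (_ || _); apply: cP => [i|i j]; rewrite !env_cons2;
    do ?case: ifP => _; rewrite ?(um_refl D_um) // ?(um_sym D_um (emb y)) ?(um_sym D_um (emb y')).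
pose table := [ffun lab : 'I_k.+2 * K * K =>
  [exists x, exists y, [&& x != y, DG x y == lab.1.1, c (emb x) == lab.1.2,
     c (emb y) == lab.2 & adj x y]]].
exists DG, (fun x => (c (emb x), table)); split=> [|x y xy].
  split=> [x y|x y|x y z|x y]; rewrite /DG.
  - by rewrite (um_eq0 D_um) (inj_eq emb_inj).
  - exact: um_sym D_um _ _.
  - by case: D_um.
  - exact: um_bound D_um _ _.
rewrite /= ffunE /= inordK ?ltnS ?(um_bound D_um) //.
apply/idP/existsP => [axy|[x' /existsP[y' /and5P[xy' /eqP ED /eqP Ex /eqP Ey]]]].
  by exists x; apply/existsP; exists y; rewrite xy axy !eqxx.
by rewrite (adjE x y x' y').
Qed.

(** * Transductions from decompositions *)

Lemma transduce_marked (C : graph_class) (p : nat) (a : 'I_p) (phi : formula p 1 2)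
    (G F : sgraph) (P : 'I_p -> pred F) (f : G -> F) :
  C F -> injective f -> (forall v, P a v = [exists x, f x == v]) ->
  (forall x y, x != y ->
    adj x y = sat2 (U := copy_structure 1 P) phi (f x, ord0) (f y, ord0)) ->
  transduce (Transduction (FNot (FFalse p 1 0)) (FParam 1 a ord0) phi) C G.
Proof.
move=> CF f_inj Pa fE; exists F; split=> //; exists P; split=> //=.
set U := copy_structure 1 P; set nu := FParam 1 a ord0.
have nuE (u : U) : sat1 nu u = [exists x, f x == u.1].
  by rewrite /sat1 /= env_cons0 Pa.
have nuf x : sat1 (U := U) nu (f x, ord0) by rewrite nuE; apply/existsP; exists x.
exists (fun x => exist _ (f x, ord0) (nuf x)) => [|x y].
  have ginv (u : {u : U | sat1 nu u}) : {x | f x == (val u).1}.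
    by apply: sigW; apply/existsP; rewrite -nuE; apply: (valP u).
  exists (fun u => sval (ginv u)) => [x|u].
    by apply: f_inj; apply/eqP; apply: (svalP (ginv _)).
  apply/val_inj => /=; rewrite (eqP (svalP (ginv u))) [RHS]surjective_pairing.
  by congr (_, _); rewrite [RHS]ord1.
rewrite /= /interp_adj -val_eqE /= xpair_eqE eqxx andbT (inj_eq f_inj).
have [->|xy] := eqVneq x y; first by rewrite adj_irr.
have yx : y != x by rewrite eq_sym.
by rewrite -(fE x y xy) -(fE y x yx) (adj_sym y) orbb.
Qed.

(** * Formulas for walks and for numbers of common neighbours *)

Section DerivedFormulas.
Variables (p m : nat) (U : fo_structure p m).

Lemma sat_and n (f g : formula p m n) (s : 'I_n -> U) :
  sat (FAnd f g) s = sat f s && sat g s.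
Proof. by []. Qed.

Lemma sat_not n (f : formula p m n) (s : 'I_n -> U) : sat (FNot f) s = ~~ sat f s.
Proof. by []. Qed.

Lemma sat_ex n (f : formula p m n.+1) (s : 'I_n -> U) :
  sat (FEx f) s = [exists x, sat f (env_cons x s)].
Proof. by []. Qed.

Definition FAny n (fs : seq (formula p m n)) : formula p m n :=
  FNot (foldr (fun f g => FAnd (FNot f) g) (FNot (FFalse p m n)) fs).

Lemma sat_any n (fs : seq (formula p m n)) (s : 'I_n -> U) :
  sat (FAny fs) s = has (fun f => sat f s) fs.
Proof.
rewrite /=; elim: fs => //= f fs IHfs; rewrite negb_and negbK.
by congr (_ || _).
Qed.

Fixpoint FWalk (l : nat) n (x y : 'I_n) : formula p m n :=
  if l is l'.+1
  then FEx (FAnd (FAdj p m (lift ord0 x) ord0) (FWalk l' ord0 (lift ord0 y)))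
  else FEq p m x y.

Lemma sat_walk l n (x y : 'I_n) (s : 'I_n -> U) :
  sat (FWalk l x y) s = walk (@fo_adj p m U) l (s x) (s y).
Proof.
elim: l n x y s => //= l IHl n x y s; apply: eq_existsb => z.
by rewrite IHl !env_consS !env_cons0.
Qed.

(** There are at least [l] common neighbours outside [zs], the list of witnesses already chosen. *)
Fixpoint FManyCommon (l : nat) n (x y : 'I_n) (zs : seq 'I_n) : formula p m n :=
  if l is l'.+1
  then FEx (FAnd (FAnd (FAdj p m (lift ord0 x) ord0) (FAdj p m (lift ord0 y) ord0))
    (FAnd (FNot (FAny [seq FEq p m ord0 (lift ord0 z) | z <- zs]))
      (FManyCommon l' (lift ord0 x) (lift ord0 y)
         (ord0 :: [seq lift ord0 z | z <- zs]))))
  else FNot (FFalse p m n).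

Lemma sat_many_common l n (x y : 'I_n) (zs : seq 'I_n) (s : 'I_n -> U) :
  sat (FManyCommon l x y zs) s =
  (l <= #|[set z | [&& fo_adj (s x) z, fo_adj (s y) z & z \notin map s zs]]|).
Proof.
elim: l n x y zs s => //= l IHl n x y zs s.
set A := [set z | _].
have inA z : ~~ sat (FAny [seq FEq p m ord0 (lift ord0 z0) | z0 <- zs]) (env_cons z s)
    = (z \notin map s zs).
  rewrite sat_any has_map; congr (~~ _); rewrite -has_pred1 has_map.
  by apply: eq_has => i /=; rewrite env_cons0 env_consS eq_sym.
have step z : z \in A ->
    sat (FManyCommon l (lift ord0 x) (lift ord0 y) (ord0 :: [seq lift ord0 z | z <- zs]))
      (env_cons z s) = (l < #|A|).
  rewrite IHl.
  have -> : map (env_cons z s) (ord0 :: map (lift ord0) zs) = z :: map s zs.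
    rewrite map_cons env_cons0 -map_comp; congr (_ :: _).
    by apply: eq_map => i /=; rewrite env_consS.
  move=> Az; rewrite (cardsD1 z A) Az add1n ltnS !env_consS; congr (_ <= _).
  apply: eq_card => w; rewrite !inE negb_or.
  by case: (w != z); rewrite ?andbF ?andbT.
apply/existsP/idP => [[z]|/[dup] lA].
  rewrite !env_consS !env_cons0 => /andP[/andP[xz yz] /andP[nz]].
  by rewrite step // inE xz yz; apply: etrans (esym (inA z)) nz.
case/(leq_trans (ltn0Sn l))/card_gt0P=> z Az; exists z.
have := Az; rewrite inE => /and3P[xz yz nz].
rewrite !env_consS !env_cons0 xz yz step // lA !andbT /=.
exact: etrans (inA z) nz.
Qed.

End DerivedFormulas.

Section Copy1.
Variables (F : sgraph) (p : nat) (P : 'I_p -> pred F).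
Let U := copy_structure 1 P.

Lemma copy1_adj (u v : U) : fo_adj u v = adj u.1 v.1.
Proof. by rewrite /= (ord1 u.2) (ord1 v.2) eqxx andbT. Qed.

Lemma exists_copy1 (Q : pred U) : [exists u, Q u] = [exists z, Q (z, ord0)].
Proof.
apply/existsP/existsP => [[[z i]]|[z]]; first by rewrite (ord1 i); exists z.
by exists (z, ord0).
Qed.

Lemma copy1_walk l (x y : F) :
  walk (@fo_adj p 1 U) l (x, ord0) (y, ord0) = walk (@adj F) l x y.
Proof.
elim: l x => [|l IHl] x; first by rewrite /= xpair_eqE eqxx andbT.
rewrite /= exists_copy1; apply: eq_existsb => z.
by rewrite IHl /= eqxx andbT.
Qed.

Lemma card_copy1 (Q : pred F) : #|[set u : U | Q u.1]| = #|[set z | Q z]|.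
Proof.
rewrite -(card_imset _ (f := fun z : F => (z, ord0) : U)); last by move=> z w [].
apply: eq_card => -[z i]; rewrite inE /=; apply/idP/imsetP => [Qz|[w + [->]]].
  by exists z; rewrite ?inE // (ord1 i).
by rewrite inE.
Qed.

End Copy1.

Definition var0 : 'I_2 := ord0.
Definition var1 : 'I_2 := lift ord0 ord0.

Lemma shrub_transduction (C : graph_class) :
  bounded_shrub_decompositions C -> structurally_bounded_treedepth C.
Proof.
case=> d [S shrubC].
(* Distance [l] means a walk of length [l] and no shorter one; the lengths in [S] are at most [d],
   so the disjunction is finite. *)
pose phi : formula 1 1 2 := FAny
  [seq FAnd (FWalk 1 1 l var0 var1) (FNot (FAny [seq FWalk 1 1 l' var0 var1 | l' <- iota 0 l]))
  | l <- [seq l <- iota 1 d | S ord0 ord0 l]].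
exists (fun F => treedepth F <= d), (Transduction (FNot (FFalse 1 1 0)) (FParam 1 ord0 ord0) phi).
split=> [|G /shrubC[F [f [c [[diam f_inj _ fS] tdF]]]]]; first by exists d.
apply: (transduce_marked (P := fun _ v => [exists x, f x == v]) (f := f)) => // x y xy.
have [l _ lxy] := diam (f x) (f y).
rewrite (fS _ _ _ lxy) !ord1 /sat2 sat_any has_map.
move/is_distP: lxy => [lw lmin].
have satw l' : sat (U := copy_structure 1 (fun _ v => [exists x, f x == v]))
    (FWalk 1 1 l' var0 var1)
    (env_cons (f x, ord0) (env_cons (f y, ord0) (@env_nil _))) = walk (@adj F) l' (f x) (f y).
  by rewrite sat_walk env_cons0 env_consS env_cons0 copy1_walk.
rewrite (eq_has (a2 := fun l' => walk (@adj F) l' (f x) (f y) &&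
    ~~ has (fun l'' => walk (@adj F) l'' (f x) (f y)) (iota 0 l'))) => [|l']; last first.
  rewrite [LHS]sat_and satw sat_not sat_any has_map; congr (_ && ~~ _).
  by apply: eq_has => l''; apply: satw.
apply/idP/hasP => [Sl|[l' + /andP[l'w]]].
  exists l; first by rewrite mem_filter Sl mem_iota add1n ltnS; case: (@sig_bound _ _ S _ _ _ Sl).
  rewrite lw; apply/hasP => -[l']; rewrite mem_iota => /= l'l /lmin.
  by rewrite leqNgt l'l.
rewrite mem_filter => /andP[Sl' _] nw.
suff -> : l = l' by [].
apply/eqP; rewrite eqn_leq lmin //= leqNgt; apply: contra nw => ll'.
by apply/hasP; exists l; rewrite ?mem_iota.
Qed.

Lemma parity_transduction (C : graph_class) :
  bounded_parity_decompositions C -> structurally_bounded_treedepth C.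
Proof.
case=> d [C' [tdC' parC]].
pose many l : formula 1 1 2 := FManyCommon 1 1 l var0 var1 [::].
(* Each disjunct says that there are exactly [l] common neighbours; the target-degree keeps [l] at
   most [d]. *)
pose phi := FAny [seq FAnd (many l) (FNot (many l.+1)) | l <- [seq l <- iota 0 d.+1 | odd l]].
exists C', (Transduction (FNot (FFalse 1 1 0)) (FParam 1 ord0 ord0) phi); split=> //.
move=> G /parC[H [e [Ce [deg par]]]].
pose f (x : G) : bip_graph e := inl x.
have f_inj : injective f by move=> x y [].
apply: (transduce_marked (P := fun _ v => [exists x, f x == v]) (f := f)) => // x y xy.
rewrite (par _ _ xy) /sat2 sat_any; set c := #|_|.
have satm l : sat (U := copy_structure 1 (fun _ v => [exists x, f x == v])) (many l)
    (env_cons (f x, ord0) (env_cons (f y, ord0) (@env_nil _))) = (l <= c).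
  rewrite sat_many_common env_cons0 env_consS env_cons0; congr (_ <= _).
  have -> : c = #|[set z | z \in nbr (f x) :&: nbr (f y)]|.
    by apply: eq_card => z; rewrite !inE.
  rewrite -(card_copy1 (fun (_ : 'I_1) v => [exists x, f x == v])).
  by apply: eq_card => u; rewrite !inE !copy1_adj andbT.
have cd : c <= d by apply: leq_trans (subset_leq_card (subsetIl _ _)) (deg x).
rewrite has_map (eq_has (a2 := fun l => (l <= c) && ~~ (l < c))) => [|l]; last first.
  by rewrite [LHS]sat_and sat_not !satm.
apply/idP/hasP => [oc|[l + /andP[lc cl]]].
  by exists c; rewrite ?leqnn ?ltnn // mem_filter oc mem_iota.
rewrite mem_filter => /andP[ol _].
by have -> : c = l by apply/eqP; rewrite eqn_leq lc leqNgt cl.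
Qed.

(** Common neighbours of [x] and [y] are weakly reachable from [x], hence form a chain on which [pi]
    increases with [rank z], the number of vertices weakly reachable from [z]. So the dominant
    vertex is the one of largest rank, and ranks, being at most [d], can be given by parameters. *)
Lemma lacon_transduction (C : graph_class) :
  bounded_lacon_decompositions C -> structurally_bounded_treedepth C.
Proof.
case=> d lacC.
pose p := 2 + d.+1.
pose target : 'I_p := lshift d.+1 ord0.
pose lab : 'I_p := lshift d.+1 ord_max.
pose above (i : nat) : 'I_p := rshift 2 (inord i).
pose common n (x y z : 'I_n) : formula p 1 n := FAnd (FAdj p 1 x z) (FAdj p 1 y z).
(* The largest rank of a common neighbour is [i.+1], and it is attained at a vertex labelled 1;
   [above i] marks the vertices of rank greater than [i]. *)
pose dom (i : nat) : formula p 1 2 :=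
  FEx (FAnd (common 3 (lift ord0 var0) (lift ord0 var1) ord0)
    (FAnd (FAnd (FParam 1 (above i) ord0) (FParam 1 lab ord0))
      (FNot (FEx (FAnd
        (common 4 (lift ord0 (lift ord0 var0)) (lift ord0 (lift ord0 var1)) ord0)
        (FParam 1 (above i.+1) ord0)))))).
pose phi := FAny [seq dom i | i <- iota 0 d].
exists (fun F => treedepth F <= d), (Transduction (FNot (FFalse p 1 0)) (FParam 1 target ord0) phi).
split=> [|G /lacC[H [e [label [pi [[pi_inj pi_target nonempty domE] wcol_d]]]]]]; first by exists d.
pose L := bip_graph e.
pose f (x : G) : L := inl x.
pose rank (z : L) := #|[set u | `[< weakly_reachable pi z u >]]|.
pose P (a : 'I_p) (z : L) := match split a with
  | inl j => if j == ord0 then [exists x, f x == z] else if z is inr h then label h else false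
  | inr i => i < rank z end.
have rank_d z : rank z <= d.
  by apply: leq_trans wcol_d; rewrite /wcol_infty (bigD1 z) //= leq_maxl.
have P_above i z : i <= d -> P (above i) z = (i < rank z).
  by move=> id; rewrite /P /above; case: splitP => j /= /eqP;
    [have := ltn_ord j; lia|rewrite inordK // eqn_add2l => /eqP <-].
have P_target z : P target z = [exists x, f x == z].
  by rewrite /P /target; case: splitP => // j /= E; rewrite ifT // -val_eqE /= -E.
have P_lab (h : H) : P lab (inr h) = label h.
  by rewrite /P /lab; case: splitP => j /= E //; rewrite ifN // -val_eqE /= -E.
have f_inj : injective f by move=> x y [].
apply: (transduce_marked (P := P) (f := f)) => //.
  by apply: leq_trans (treedepth_le_wcol pi_inj) wcol_d.
move=> x y xy.
pose N : {set L} := nbr (f x) :&: nbr (f y).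
have [z0 z0N] := set0Pn _ (nonempty x y).
case: (@arg_maxnP _ z0 (mem N) pi z0N) => z zN zmax.
have reach w : w \in N -> weakly_reachable pi (f x) w.
  rewrite !inE => /andP[xw _]; apply: weakly_reachable_adj => //.
  by case: w xw => // h _; apply/ltnW.
have rank_lt w : w \in N -> w != z -> rank w < rank z.
  move=> wN wz; have lt : pi w < pi z.
    by rewrite ltn_neqAle (inj_eq pi_inj) wz; apply: zmax.
  apply/proper_card/properP; split.
    apply/subsetP => u; rewrite !inE => /asboolP wu; apply/asboolP.
    apply: weakly_reachable_trans wu.
    exact: weakly_reachable_chain (reach w wN) (reach z zN) (ltnW lt).
  exists z; rewrite !inE; first by apply/asboolP/weakly_reachable_refl.
  by apply/asboolP => /weakly_reachable_le; rewrite leqNgt lt.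
case: z zN zmax rank_lt => [t|h] zN zmax rank_lt; first by move: zN; rewrite !inE.
have {}zN : inr h \in N by [].
rewrite (domE x y xy h) /sat2 ?sat_any; last by split=> // w; apply: zmax.
have rank0 : 0 < rank (inr h).
  by apply/card_gt0P; exists (inr h); rewrite inE; apply/asboolP/weakly_reachable_refl.
have sat_dom i : i < d -> sat (U := copy_structure 1 P) (dom i)
    (env_cons (f x, ord0) (env_cons (f y, ord0) (@env_nil _))) =
    [exists w, [&& w \in N, i < rank w, P lab w & ~~ [exists w', (w' \in N) && (i.+1 < rank w')]]].
  move=> id; have commonE n (a b z : 'I_n) (s : 'I_n -> copy_structure 1 P) :
      sat (common n a b z) s = adj (s a).1 (s z).1 && adj (s b).1 (s z).1.
    by rewrite sat_and; congr (_ && _); apply: copy1_adj.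
  have paramE n a (z : 'I_n) (s : 'I_n -> copy_structure 1 P) :
      sat (FParam 1 a z) s = P a (s z).1 by [].
  have NE w : (w \in N) = adj (f x) w && adj (f y) w by rewrite !inE.
  rewrite sat_ex exists_copy1; apply: eq_existsb => w.
  rewrite sat_and commonE sat_and sat_and sat_not !paramE !env_consS !env_cons0.
  rewrite P_above ?(ltnW id) // NE -!andbA; do 4!congr (_ && _); congr (~~ _).
  rewrite sat_ex exists_copy1; apply: eq_existsb => w'.
  by rewrite sat_and commonE paramE !env_consS !env_cons0 P_above // NE.
rewrite has_map; apply/idP/hasP => [lh|[i]].
  have rd : (rank (inr h)).-1 < d by rewrite prednK.
  exists (rank (inr h)).-1; first by rewrite mem_iota.
  rewrite [preim _ _ _]sat_dom //; apply/existsP; exists (inr h).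
  rewrite zN prednK // leqnn P_lab lh; apply/existsPn => w; apply/negP => /andP[wN].
  by have [->|/(rank_lt _ wN)] := eqVneq w (inr h); lia.
rewrite mem_iota => id; rewrite [preim _ _ _]sat_dom //.
case/existsP=> w /and4P[wN iw Pw /existsPn/(_ (inr h))].
rewrite zN /= -leqNgt => hi; move: Pw.
have [->|/(rank_lt _ wN)] := eqVneq w (inr h); first by rewrite P_lab.
by lia.
Qed.

Theorem theorem7 (C : graph_class) :
  [<-> structurally_bounded_treedepth C;
       bounded_lacon_decompositions C;
       bounded_shrub_decompositions C;
       bounded_parity_decompositions C].
Proof.
(* Passing from one kind of decomposition to another goes through a transduction and a tree
   model. *)
tfae=> [/transduction_tree_models[k [K [R mC]]]|||/parity_transduction//].
- exists (k.+1 * #|{set K}|.+1) => G /mC[D [c [D_um adjR]]].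
  have [label [pi lacon]] := tree_model_lacon D_um adjR.
  by do 4!eexists; apply: lacon.
- by move/lacon_transduction/transduction_tree_models/tree_models_shrub.
- move/shrub_transduction/transduction_tree_models=> [k [K [R mC]]].
  exists (k.+1 * #|{set K}|), (fun F => treedepth F <= k.+1 * #|{set K}|.+1).
  split=> [|G /mC[D [c [D_um adjR]]]]; first by exists (k.+1 * #|{set K}|.+1).
  have [sel par] := tree_model_parity D_um adjR.
  by do 2!eexists; split; [|exact: par]; apply: tree_inc_treedepth.
Qed.
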